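(* There exist problem-independent (absolute) constants $C_1,C_2,C_3,C_M,C_\nu,C_s>0$ such that the following holds. Let $r\le d\le n$ be positive integers. Suppose that $\epsilon,\delta\in(0,C_3)$, $m,s$ are positive integers and $E>0$ satisfy $$1\le s\le C_sC_2^{-1}\epsilon^{-1}[4r+\log(1/\delta)],$$ $$C_M\le E\le C_2^2\epsilon^2 s\,[4r+\log(1/\delta)]^{-1}e^{C_s(C_2\epsilon s)^{-1}[4r+\log(1/\delta)]},$$ $$m\ge\max\left\{E\,C_2^{-2}\epsilon^{-2}[4r+\log(1/\delta)],\ s e\right\},$$ where $e$ is Euler's number. Then for any matrix $A\in\mathbb{R}^{n\times d}$ with rank $r$ and $\mu(A)\le\sqrt{s}\,C_\nu C_1^{-1}\bar\mu(\epsilon,\delta)$, where $$\bar\mu(\epsilon,\delta):=C_1\sqrt{C_2}\sqrt{\epsilon}\,\min\left\{\frac{\log(E/(C_2\epsilon))}{4r+\log(1/\delta)},\ \sqrt{\frac{\log(E)}{4r+\log(1/\delta)}}\right\},$$ a randomly generated $s$-hashing matrix $S\in\mathbb{R}^{m\times n}$ is an $\epsilon$-subspace embedding for $A$ with probability at least $1-\delta$.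
   Context: Compact SVD: a matrix $A\in\mathbb{R}^{n\times d}$ of rank $r$ is written $A=U\Sigma V^T$ with $U\in\mathbb{R}^{n\times r}$, $V\in\mathbb{R}^{d\times r}$ having orthonormal columns and $\Sigma\in\mathbb{R}^{r\times r}$ diagonal with strictly positive diagonal entries. Coherence: $\mu(A)=\max_{1\le i\le n}\|U_i\|_2$, where $U_i$ is the $i$th row of $U$. $\epsilon$-subspace embedding (throughout, $\epsilon\in(0,1)$): $S\in\mathbb{R}^{m\times n}$ is an $\epsilon$-subspace embedding for $B\in\mathbb{R}^{n\times k}$ if $(1-\epsilon)\|y\|_2^2\le\|Sy\|_2^2\le(1+\epsilon)\|y\|_2^2$ for all $y\in\{Bz: z\in\mathbb{R}^k\}$. $s$-hashing matrix: a random matrix $S\in\mathbb{R}^{m\times n}$ such that, independently for each column $j\in\{1,\dots,n\}$, one samples without replacement $i_1,\dots,i_s\in\{1,\dots,m\}$ uniformly at random and sets $S_{i_kj}=\pm1/\sqrt{s}$ (independent uniformly random signs) for $k=1,\dots,s$, all other entries of the column being $0$. *)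

(* Defs.v *)
From HB Require Import structures.
From mathcomp Require Import all_boot all_order all_algebra.
From mathcomp Require Import all_classical all_reals all_analysis.
Set Implicit Arguments.
Unset Strict Implicit.
Unset Printing Implicit Defensive.
Import Order.TTheory GRing.Theory Num.Theory.
Local Open Scope classical_set_scope.
Local Open Scope ring_scope.

(* Euclidean norm; the library norm `|x| of a matrix is the sup norm. *)
Definition norm2 (R : realType) (n : nat) (x : 'cV[R]_n) : R :=
  Num.sqrt (\sum_(i < n) x i 0 ^+ 2).

Definition compact_svd (R : realType) (n d r : nat) (A : 'M[R]_(n, d))
    (U : 'M[R]_(n, r)) (Sigma : 'M[R]_r) (V : 'M[R]_(d, r)) : Prop :=
  [/\ A = U *m Sigma *m V^T,
      U^T *m U = 1%:M,
      V^T *m V = 1%:M,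
      is_diag_mx Sigma
    & forall i, 0 < Sigma i i].

(* The left factor of some compact SVD of A.  Two such factors differ by an
   orthogonal matrix on the right, so the row norms used in [coherence] do not
   depend on the choice; every real matrix has a compact SVD, so the default 0
   is never returned. *)
Definition svd_left (R : realType) (n d : nat) (A : 'M[R]_(n, d)) :
    'M[R]_(n, \rank A) :=
  xget 0 [set U : 'M[R]_(n, \rank A) |
           exists (Sigma : 'M[R]_(\rank A)) (V : 'M[R]_(d, \rank A)),
             compact_svd A U Sigma V].

(* The norms are nonnegative, so 0 is a neutral starting value for the max. *)
Definition coherence (R : realType) (n d : nat) (A : 'M[R]_(n, d)) : R :=
  \big[Num.max/0]_(i < n) norm2 (row i (svd_left A))^T.

Definition subspace_embedding (R : realType) (m n k : nat) (eps : R)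
    (S : 'M[R]_(m, n)) (B : 'M[R]_(n, k)) : Prop :=
  forall y : 'cV[R]_n, (exists z : 'cV[R]_k, y = B *m z) ->
    (1 - eps) * norm2 y ^+ 2 <= norm2 (S *m y) ^+ 2 <= (1 + eps) * norm2 y ^+ 2.

(* The raw randomness of one column: the positions i_1, ..., i_s and the signs
   (true standing for -1). *)
Definition column_sample (m s : nat) : finType :=
  ({ffun 'I_s -> 'I_m} * {ffun 'I_s -> bool})%type.

Definition admissible_samples (m s : nat) : {set column_sample m s} :=
  [set x : column_sample m s | injectiveb x.1].

Definition hashing_mx (R : realType) (m n s : nat)
    (x : 'I_n -> column_sample m s) : 'M[R]_(m, n) :=
  \matrix_(i < m, j < n)
    \sum_(k < s | (x j).1 k == i) (-1) ^+ ((x j).2 k : bool) / Num.sqrt s%:R.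

Definition mutually_independent (R : realType) (dT : measure_display)
    (T : measurableType dT) (P : probability T R) (I C : finType)
    (X : I -> T -> C) : Prop :=
  forall (J : {set I}) (B : I -> set C),
    P (\bigcap_(i in [set` J]) (X i @^-1` B i)) =
    (\prod_(i in J) P (X i @^-1` B i))%E.

(* Sampling s positions uniformly without replacement together with s
   independent uniform signs is the uniform law on [admissible_samples]. *)
Definition s_hashing (R : realType) (dT : measure_display)
    (T : measurableType dT) (P : probability T R) (m n s : nat)
    (S : T -> 'M[R]_(m, n)) : Prop :=
  exists X : 'I_n -> T -> column_sample m s,
    [/\ forall j (B : set (column_sample m s)), measurable (X j @^-1` B),
        forall j x, P (X j @^-1` [set x]) =
          (if x \in admissible_samples m s
           then #|admissible_samples m s|%:R^-1 else 0)%:E,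
        mutually_independent P X
      & forall w, S w = hashing_mx R (fun j => X j w)].

Definition rlog (R : realType) (r : nat) (delta : R) : R :=
  4 * r%:R + ln (1 / delta).

Definition mu_bar (R : realType) (C1 C2 E : R) (r : nat) (eps delta : R) : R :=
  C1 * Num.sqrt C2 * Num.sqrt eps *
  Num.min (ln (E / (C2 * eps)) / rlog r delta)
          (Num.sqrt (ln E / rlog r delta)).

(* Main.v *)
Require Import Defs.
From HB Require Import structures.
From mathcomp Require Import all_boot all_order all_algebra.
From mathcomp Require Import perm.
From mathcomp Require Import all_classical all_reals all_analysis.
From mathcomp Require Import ring lra zify.
Set Implicit Arguments.
Unset Strict Implicit.
Unset Printing Implicit Defensive.
Import Order.TTheory GRing.Theory Num.Theory.
Local Open Scope classical_set_scope.
Local Open Scope ring_scope.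

(** Let [U] be the left singular factor of [A], [L = 4 r + ln (1 / delta)] and
    [Q w = |S U w|^2 - |U w|^2].  Since [U] is an isometry, the claim is that
    [|Q w| <= eps |w|^2] for every [w].

    Reduction to one vector.  A grid of at most [2 ^ (66 r)] vectors in the unit
    ball controls a quadratic form up to a factor two ([quad_form_net],
    [card_grid_net]).  As [L] exceeds [4 r], the union bound over the grid is
    affordable once the [p]-th moment of [Q w] is at most
    [(eps / 2) ^ p * 2 ^ (- 17 p)] for an even [p] with [L <= p <= 2 L]
    ([failure_weight_le_moments], [net_union_tail]).

    Independent rows.  Put [x = U w]; coherence and Cauchy-Schwarz give
    [|x j| <= nu].  Every column of [S] has exactly [s] nonzero entries, so the
    diagonal terms of [|S x|^2] add up to [|x|^2] and [s * Q w] is the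
    off-diagonal chaos [\sum_k \sum_(i != j) c k i * c k j * x i * x j]
    ([hash_chaos_energy]).  In the expansion of its [p]-th power a monomial has
    mean zero unless all its exponents are even, and otherwise its mean is at
    most [rho ^ (number of distinct entries)] with [rho = s / m], because
    sampling without replacement makes joint hits rarer ([hash_monomial_le]).
    This is the mean the monomial has when the entries are independent, zero
    with probability [1 - rho] and a random sign otherwise.  So the moment is
    at most that of the independent model, with [x] replaced by [|x|].  There
    the rows are independent and identically distributed, and comparing
    coefficients in the product of the truncated exponential series of the rows
    bounds the [p]-th moment by
    [p! * lam ^- p * (\sum_(q <= p) lam ^ q * mu q / q!) ^ m]
    ([iid_sum_moment]), [mu q] being the moments of one row.  Stopping the
    series at order [p] is essential: for the [lam] used below, of order
    [p / (eps s)], the full exponential moment of a row can be far too large.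

    One row.  Sort the monomials of [mu q] by the set of columns that occur.
    This set has [l >= 2] elements, and [row_moment_le] follows from
    [|x j| <= nu], a count of index sequences and a bound on the [l]-th
    elementary symmetric function of the [x j ^ 2].  With [q = l + a] the
    summand becomes [(e^2 lam rho) ^ l * (c l^2 / q) ^ a], where
    [c = e lam nu^2].  For [l = 2] the sum over [a] is at most [exp (4 c)],
    which the bound of [nu] through [sqrt (ln E / L)] keeps below [E]; the
    factor [1 / E] in [rho] pays for it.  For [l >= 3] the restriction
    [q <= p] and the bound of [nu] through [b / L], where
    [b = ln (E / (C2 eps))], make the sum over [a] at most [exp (b l / 3) <= exp (b (l - 2))], which is compensated
    by [l - 2] of the factors [e^2 lam rho].  Altogether the series of a row is
    at most [1 + p / m] ([row_generating_le], [moment_parameters]), hence its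
    [m]-th power at most [exp p].

    The coherence speaks about a compact singular value decomposition, whose
    existence is proved from a maximiser of [|A v|] on the unit sphere and
    deflation ([svd_leftP]). *)

(** * Moments of sums of independent copies *)

Definition truncated_exp (R : realType) (p : nat) (x : R) : {poly R} :=
  \poly_(q < p.+1) (x ^+ q / q`!%:R).

(** Up to order [p], the coefficients of the product are those of
    [exp (X * \sum_i z i)], since a coefficient of order [q] only sees the
    coefficients of order at most [q] of the factors. *)
Lemma coef_prod_truncated_exp (R : realType) (I : finType) (p : nat)
    (z : I -> R) (q : nat) : (q <= p)%N ->
  (\prod_i truncated_exp p (z i))`_q = (\sum_i z i) ^+ q / q`!%:R.
Proof.
move: q.
apply: (big_ind2 (fun (P : {poly R}) x =>
  forall q, (q <= p)%N -> P`_q = x ^+ q / q`!%:R)) => [q qp|P x P' x' HP HP' q qp|i _ q qp].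
- rewrite coef1 expr0n; case: q {qp} => [|q]; last by rewrite mul0r.
  by rewrite fact0 invr1 mulr1.
- rewrite coefM addrC exprDn mulr_suml; apply: eq_bigr => i _.
  have iq : (i <= q)%N by rewrite -ltnS.
  rewrite HP ?(leq_trans iq) // HP' ?(leq_trans (leq_subr _ _)) //.
  rewrite -mulr_natr -(bin_fact iq) !natrM.
  have f0 k : (k`!%:R : R) != 0 by rewrite pnatr_eq0 -lt0n fact_gt0.
  have b0 : ('C(q, i)%:R : R) != 0 by rewrite pnatr_eq0 -lt0n bin_gt0.
  by field; rewrite !f0 b0.
- by rewrite coef_poly ltnS qp.
Qed.

Lemma coef_le_horner1 (R : realType) (P : {poly R}) (q : nat) :
  (forall k, 0 <= P`_k) -> P`_q <= P.[1].
Proof.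
move=> P0; rewrite horner_coef.
have [qP|Pq] := ltnP q (size P); last first.
  by rewrite (nth_default _ Pq); apply: sumr_ge0 => i _; rewrite expr1n mulr1.
rewrite (bigD1 (Ordinal qP)) //= expr1n mulr1 lerDl.
by apply: sumr_ge0 => i _; rewrite expr1n mulr1.
Qed.

(** Both sides come from the polynomial
    [(\sum_b wt b *: truncated_exp p (t * z b)) ^+ m]: its coefficient of
    order [p] is the left-hand side, its value at 1 the right-hand side, and
    nonnegative moments make a coefficient smaller than the value at 1.  The
    [z b] themselves may be negative, so the comparison is only possible after
    averaging. *)
Lemma iid_sum_moment (R : realType) (T : finType) (wt z : T -> R)
    (m p : nat) (t : R) :
  (forall q, 0 <= \sum_b wt b * z b ^+ q) -> 0 <= t ->
  t ^+ p / p`!%:R *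
    (\sum_(B : {ffun 'I_m -> T}) (\prod_k wt (B k)) * (\sum_k z (B k)) ^+ p)
  <= (\sum_(q < p.+1) t ^+ q / q`!%:R * \sum_b wt b * z b ^+ q) ^+ m.
Proof.
move=> mu0 t0.
pose G : {poly R} := \sum_b wt b *: truncated_exp p (t * z b).
have GE q : G`_q = if (q < p.+1)%N then
    t ^+ q / q`!%:R * \sum_b wt b * z b ^+ q else 0.
  rewrite coef_sum; case: ifP => qp.
    rewrite mulr_sumr; apply: eq_bigr => b _.
    by rewrite coefZ coef_poly qp exprMn; ring.
  by rewrite big1 // => b _; rewrite coefZ coef_poly qp mulr0.
have G0 q : 0 <= G`_q.
  by rewrite GE; case: ifP => // _; rewrite mulr_ge0 // divr_ge0 // exprn_ge0.
have Gm0 k q : 0 <= (G ^+ k)`_q.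
  elim: k q => [|k IH] q; first by rewrite expr0 coef1 ler0n.
  by rewrite exprS coefM sumr_ge0 // => i _; rewrite mulr_ge0.
have Gm : G ^+ m = \sum_(B : {ffun 'I_m -> T})
    (\prod_k wt (B k)) *: \prod_k truncated_exp p (t * z (B k)).
  rewrite -[in LHS](card_ord m) -prodr_const.
  rewrite (bigA_distr_bigA (fun (_ : 'I_m) b => wt b *: truncated_exp p (t * z b))).
  by apply: eq_bigr => B _; rewrite scaler_prod.
have -> : (\sum_(q < p.+1) t ^+ q / q`!%:R * \sum_b wt b * z b ^+ q) ^+ m
    = (G ^+ m).[1].
  rewrite horner_exp; congr (_ ^+ _).
  have sG : (size G <= p.+1)%N by apply/leq_sizeP => j pj; rewrite GE ltnNge pj.
  rewrite (horner_coef_wide _ sG); apply: eq_bigr => q _.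
  by rewrite GE ltn_ord expr1n mulr1.
apply: le_trans (coef_le_horner1 p (Gm0 m)).
rewrite Gm coef_sum mulr_sumr; apply: ler_sum => B _.
rewrite coefZ coef_prod_truncated_exp // -mulr_sumr exprMn.
by rewrite le_eqVlt; apply/orP; left; apply/eqP; ring.
Qed.

(** * Powers of quadratic forms, monomial by monomial *)

(** The exponent of the variable [x] in the monomial chosen by [f] when the
    [p]-th power of a quadratic form is expanded, each factor [t] contributing
    the two variables [u (f t)] and [v (f t)]. *)
Definition multiplicity (p : nat) (G V : finType) (u v : G -> V)
    (f : {ffun 'I_p -> G}) (x : V) : nat :=
  \sum_t ((u (f t) == x) + (v (f t) == x))%N.

Lemma prod_multiplicity (R : realType) (p : nat) (G V : finType) (u v : G -> V)
    (f : {ffun 'I_p -> G}) (c : V -> R) :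
  \prod_t (c (u (f t)) * c (v (f t))) = \prod_x c x ^+ multiplicity u v f x.
Proof.
under [RHS]eq_bigr => x _ do rewrite /multiplicity -prodrXr.
rewrite exchange_big /=; apply: eq_bigr => t _.
under [RHS]eq_bigr => x _ do rewrite exprD.
rewrite big_split /=; congr (_ * _).
- rewrite (bigD1 (u (f t))) //= eqxx expr1 big1 ?mulr1 // => x.
  by rewrite eq_sym => /negbTE ->; rewrite expr0.
- rewrite (bigD1 (v (f t))) //= eqxx expr1 big1 ?mulr1 // => x.
  by rewrite eq_sym => /negbTE ->; rewrite expr0.
Qed.

Lemma quadratic_pow_expand (R : realType) (p : nat) (G V : finType)
    (u v : G -> V) (a : G -> R) (c : V -> R) :
  (\sum_g a g * (c (u g) * c (v g))) ^+ p =
  \sum_(f : {ffun 'I_p -> G})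
     (\prod_t a (f t)) * \prod_x c x ^+ multiplicity u v f x.
Proof.
rewrite -[in LHS](card_ord p) -prodr_const.
rewrite (bigA_distr_bigA (fun (_ : 'I_p) g => a g * (c (u g) * c (v g)))).
by apply: eq_bigr => f _; rewrite big_split /= (prod_multiplicity u v f c).
Qed.

(** The moment of a quadratic form is linear in the means of the monomials,
    so a comparison of these means gives a comparison of the moments once the
    coefficients are replaced by their absolute values. *)
Lemma moment_domination (R : realType) (p : nat) (G V O1 O2 : finType)
    (u v : G -> V) (a : G -> R) (w1 : O1 -> R) (c1 : O1 -> V -> R)
    (w2 : O2 -> R) (c2 : O2 -> V -> R) :
  (forall e : V -> nat, `|\sum_o w1 o * \prod_x c1 o x ^+ e x|
                        <= \sum_o w2 o * \prod_x c2 o x ^+ e x) ->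
  \sum_o w1 o * (\sum_g a g * (c1 o (u g) * c1 o (v g))) ^+ p
  <= \sum_o w2 o * (\sum_g `|a g| * (c2 o (u g) * c2 o (v g))) ^+ p.
Proof.
move=> dom.
under eq_bigr => o _ do rewrite quadratic_pow_expand mulr_sumr.
under [leRHS]eq_bigr => o _ do rewrite quadratic_pow_expand mulr_sumr.
rewrite exchange_big [leRHS]exchange_big /=; apply: ler_sum => f _.
under eq_bigr => o _ do rewrite mulrCA.
under [leRHS]eq_bigr => o _ do rewrite mulrCA.
rewrite -!mulr_sumr -normr_prod (le_trans (ler_norm _)) // normrM.
by rewrite ler_wpM2l.
Qed.

(** * Sparse independent signs *)

(** An entry of the comparison model: [None] stands for 0, [Some c] for the
    sign [(-1) ^+ c]. *)
Definition sign_val (R : realType) (b : option bool) : R :=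
  if b is Some c then (-1) ^+ (c : bool) else 0.

Definition sign_wt (R : realType) (rho : R) (b : option bool) : R :=
  if b is Some _ then rho / 2 else 1 - rho.

Definition sign_moment (R : realType) (rho : R) (e : nat) : R :=
  if e == 0%N then 1 else if odd e then 0 else rho.

Lemma sign_moment_ge0 (R : realType) (rho : R) (e : nat) :
  0 <= rho -> 0 <= sign_moment rho e.
Proof. by rewrite /sign_moment => rho0; case: eqP => // _; case: odd. Qed.

Lemma sum_sign_moment (R : realType) (rho : R) (e : nat) :
  \sum_b sign_wt rho b * sign_val R b ^+ e = sign_moment rho e.
Proof.
rewrite (bigD1 None) //= (bigD1 (Some true)) //= (bigD1 (Some false)) //=.
rewrite big1 ?addr0; last by case=> [[]|].
rewrite expr0 expr1 expr1n.
rewrite /sign_moment -signr_odd expr0n; case: e => [|e] /=; first by field.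
by case: (odd e); rewrite /= ?expr0 ?expr1; field.
Qed.

Lemma product_expectation (R : realType) (I T : finType) (w : I -> T -> R)
    (g : I -> T -> R) :
  \sum_(f : {ffun I -> T}) (\prod_i w i (f i)) * (\prod_i g i (f i)) =
  \prod_i \sum_t w i t * g i t.
Proof.
rewrite bigA_distr_bigA; apply: eq_bigr => f _.
by rewrite big_split.
Qed.

Definition row_wt (R : realType) (n : nat) (rho : R)
    (b : {ffun 'I_n -> option bool}) : R := \prod_j sign_wt rho (b j).

Lemma row_monomial (R : realType) (n : nat) (rho : R) (e : 'I_n -> nat) :
  \sum_b row_wt rho b * \prod_j sign_val R (b j) ^+ e j
  = \prod_j sign_moment rho (e j).
Proof.
rewrite (product_expectation (fun=> sign_wt rho) (fun j c => sign_val R c ^+ e j)).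
by apply: eq_bigr => j _; rewrite sum_sign_moment.
Qed.

Lemma matrix_monomial (R : realType) (m n : nat) (rho : R)
    (e : 'I_m * 'I_n -> nat) :
  \sum_(B : {ffun 'I_m -> {ffun 'I_n -> option bool}})
     (\prod_k row_wt rho (B k)) * \prod_x sign_val R (B x.1 x.2) ^+ e x
  = \prod_x sign_moment rho (e x).
Proof.
have pairE (F : 'I_m * 'I_n -> R) : \prod_x F x = \prod_k \prod_j F (k, j).
  by rewrite pair_bigA; apply: eq_bigr => -[].
rewrite [RHS]pairE; under [LHS]eq_bigr => B _ do
  rewrite (pairE (fun x => sign_val R (B x.1 x.2) ^+ e x)) /=.
rewrite (product_expectation (fun=> @row_wt R n rho)
  (fun k b => \prod_j sign_val R (b j) ^+ e (k, j))).
by apply: eq_bigr => k _; rewrite (row_monomial rho (fun j => e (k, j))).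
Qed.

(** * The moments of one row *)

Definition offdiag_coef (R : realType) (n : nat) (y : 'I_n -> R)
    (g : 'I_n * 'I_n) : R := (g.1 != g.2)%:R * (y g.1 * y g.2).

Definition row_chaos (R : realType) (n : nat) (y : 'I_n -> R)
    (b : {ffun 'I_n -> option bool}) : R :=
  \sum_g offdiag_coef y g * (sign_val R (b g.1) * sign_val R (b g.2)).

Definition row_moment (R : realType) (n : nat) (rho : R) (y : 'I_n -> R)
    (q : nat) : R :=
  \sum_b row_wt rho b * row_chaos y b ^+ q.

Lemma row_moment_expand (R : realType) (n : nat) (rho : R) (y : 'I_n -> R)
    (q : nat) :
  row_moment rho y q =
  \sum_(f : {ffun 'I_q -> 'I_n * 'I_n}) (\prod_t offdiag_coef y (f t)) *
     \prod_j sign_moment rho (multiplicity fst snd f j).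
Proof.
rewrite /row_moment.
under eq_bigr => b _ do
  rewrite /row_chaos (quadratic_pow_expand q fst snd _ (fun j => sign_val R (b j)))
          mulr_sumr.
rewrite exchange_big /=; apply: eq_bigr => f _.
rewrite -row_monomial mulr_sumr; apply: eq_bigr => b _.
by rewrite mulrCA.
Qed.

Lemma row_moment_ge0 (R : realType) (n : nat) (rho : R) (y : 'I_n -> R)
    (q : nat) : 0 <= rho -> (forall j, 0 <= y j) -> 0 <= row_moment rho y q.
Proof.
move=> rho0 y0; rewrite row_moment_expand; apply: sumr_ge0 => f _.
rewrite mulr_ge0 ?prodr_ge0 // => j _; first by rewrite !mulr_ge0.
exact: sign_moment_ge0.
Qed.


Definition hit_set (n q : nat) (f : {ffun 'I_q -> 'I_n * 'I_n}) : {set 'I_n} :=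
  [set j | (0 < multiplicity fst snd f j)%N]%SET.

Lemma sum_multiplicity (n q : nat) (f : {ffun 'I_q -> 'I_n * 'I_n}) :
  (\sum_j multiplicity fst snd f j = q.*2)%N.
Proof.
rewrite exchange_big /= (eq_bigr (fun=> 2%N)); last first.
  move=> t _; rewrite big_split /=.
  have c (i : 'I_n) : (\sum_j (i == j) = 1)%N.
    rewrite (bigD1 i) //= eqxx big1 // => j.
    by rewrite eq_sym => /negbTE ->.
  by rewrite !c.
by rewrite sum_nat_const card_ord muln2.
Qed.

(** A nonzero term has only even exponents, so every column of the hit set
    occurs at least twice; two occurrences are kept as [y j ^+ 2] and the others
    are bounded by [nu].  Since each factor is off the diagonal, the hit set has
    at least two elements. *)
Lemma chaos_term_le (R : realType) (n q : nat) (rho nu : R) (y : 'I_n -> R)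
    (f : {ffun 'I_q -> 'I_n * 'I_n}) :
  (0 < q)%N -> 0 <= rho -> (forall j, 0 <= y j <= nu) ->
  (\prod_t offdiag_coef y (f t)) *
     \prod_j sign_moment rho (multiplicity fst snd f j)
  <= (2 <= #|hit_set f| <= q)%N%:R *
     (rho ^+ #|hit_set f| * (\prod_(j in hit_set f) y j ^+ 2) *
      nu ^+ (q - #|hit_set f|).*2).
Proof.
move=> q0 rho0 y0nu.
have y0 j : 0 <= y j by have /andP[] := y0nu j.
have ynu j : y j <= nu by have /andP[] := y0nu j.
set A := hit_set f.
have rhs0 : 0 <= (2 <= #|A| <= q)%N%:R *
     (rho ^+ #|A| * (\prod_(j in A) y j ^+ 2) * nu ^+ (q - #|A|).*2).
  rewrite mulr_ge0 // !mulr_ge0 ?exprn_ge0 ?prodr_ge0 // => [j _|].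
    by rewrite exprn_ge0.
  by case: {f A} (f (Ordinal q0)) => j _; apply: le_trans (ynu j).
have [/forallP offd|/forallPn[t tP]] := boolP [forall t, (f t).1 != (f t).2];
  last first.
  by rewrite (bigD1 t) //= /offdiag_coef (negbTE tP) !mul0r.
have [/forallP ev|/forallPn[j]] :=
    boolP [forall j, ~~ odd (multiplicity fst snd f j)]; last first.
  rewrite negbK => oj; rewrite [X in _ * X](bigD1 j) //= {1}/sign_moment oj.
  by case: eqP oj => [->|_ _] //; rewrite mul0r mulr0.
have mA j : j \in A -> (2 <= multiplicity fst snd f j)%N.
  rewrite inE; case: (multiplicity _ _ _ _) (ev j) => [|[|]] //.
have mA0 j : j \notin A -> multiplicity fst snd f j = 0%N.
  by rewrite inE -eqn0Ngt => /eqP.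
have sA : (\sum_(j in A) multiplicity fst snd f j = q.*2)%N.
  rewrite -(sum_multiplicity f) [RHS](bigID (mem A)) /= [X in (_ + X)%N]big1 ?addn0 //.
have cA : (#|A|.*2 <= q.*2)%N.
  by rewrite -sA -muln2 -sum_nat_const leq_sum.
have A2 : (2 <= #|A|)%N.
  have /= := offd (Ordinal q0); case E : (f (Ordinal q0)) => [i j] /= ij.
  apply: (@leq_trans #|[set i; j]%SET|); first by rewrite cards2 ij.
  apply: subset_leq_card; apply/fintype.subsetP => k; rewrite !inE => /orP[] /eqP ->.
  - by rewrite /multiplicity (bigD1 (Ordinal q0)) //= E eqxx.
  - by rewrite /multiplicity (bigD1 (Ordinal q0)) //= E eqxx /= addn1.
rewrite A2 -leq_double cA mul1r.
have -> : \prod_t offdiag_coef y (f t) = \prod_j y j ^+ multiplicity fst snd f j.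
  rewrite -prod_multiplicity; apply: eq_bigr => t _.
  by rewrite /offdiag_coef offd mul1r.
have -> : \prod_j sign_moment rho (multiplicity fst snd f j) = rho ^+ #|A|.
  rewrite (bigID (mem A)) /= [X in _ * X]big1 ?mulr1; last first.
    by move=> j jA; rewrite mA0.
  rewrite -prodr_const; apply: eq_bigr => j jA.
  by rewrite /sign_moment (negbTE (ev j)); case: eqP (mA j jA) => // ->.
rewrite mulrC -mulrA ler_wpM2l ?exprn_ge0 //.
have -> : nu ^+ (q - #|A|).*2 =
    \prod_(j in A) nu ^+ (multiplicity fst snd f j - 2).
  rewrite prodrXr; congr (_ ^+ _).
  by rewrite sumnB // sA sum_nat_const doubleB muln2.
rewrite -big_split /= (bigID (mem A)) /= [X in _ * X]big1 ?mulr1; last first.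
  by move=> j jA; rewrite mA0.
apply: ler_prod => j jA; rewrite exprn_ge0 //=.
rewrite -{1}(subnKC (mA j jA)) exprD ler_wpM2l ?exprn_ge0 //.
by rewrite lerXn2r ?nnegrE // (le_trans (y0 j)).
Qed.

Lemma row_moment0 (R : realType) (n : nat) (rho : R) (y : 'I_n -> R) :
  row_moment rho y 0 = 1.
Proof.
have := row_monomial (n := n) rho (fun=> 0%N); rewrite [RHS]big1 // => <-.
apply: eq_bigr => b _; rewrite expr0; congr (_ * _).
by rewrite big1 // => j _; rewrite expr0.
Qed.

(** The elementary symmetric function of degree [l], scaled by [l ^ l], is
    part of the expansion of [\prod_j (1 + l * x j) <= expR l]. *)
Lemma sum_prod_subsets_le (R : realType) (n l : nat) (x : 'I_n -> R) :
  (forall j, 0 <= x j) -> \sum_j x j <= 1 ->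
  \sum_(A : {set 'I_n} | #|A| == l) \prod_(j in A) x j <= (expR 1 / l%:R) ^+ l.
Proof.
move=> x0 x1; case: l => [|l].
  rewrite expr0 (big_pred1 finset.set0); last by move=> A; rewrite cards_eq0.
  by rewrite big1 // => j; rewrite finset.in_set0.
rewrite expr_div_n -expRM_natl mulr1.
rewrite ler_pdivlMr ?exprn_gt0 ?ltr0n // mulr_suml.
have -> : \sum_(A : {set 'I_n} | #|A| == l.+1) (\prod_(j in A) x j) * l.+1%:R ^+ l.+1
   = \sum_(A : {set 'I_n} | #|A| == l.+1) \prod_(j in A) (l.+1%:R * x j).
  by apply: eq_bigr => A /eqP cA; rewrite big_split /= prodr_const cA mulrC.
apply: (@le_trans _ _ (\sum_(A : {set 'I_n}) \prod_(j in A) (l.+1%:R * x j))).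
  rewrite [leRHS](bigID (fun A : {set 'I_n} => #|A| == l.+1)) /= lerDl.
  by apply: sumr_ge0 => A _; apply: prodr_ge0 => j _; rewrite mulr_ge0.
have -> : \sum_(A : {set 'I_n}) \prod_(j in A) (l.+1%:R * x j) =
          \prod_j (l.+1%:R * x j + 1).
  rewrite bigA_distr /=; apply: eq_bigr => A _.
  by rewrite [RHS](bigID (mem A)) /= [X in _ = _ * X]big1 ?mulr1 //; [
     apply: eq_bigr => j -> | move=> j /negbTE ->].
apply: (@le_trans _ _ (\prod_j expR (l.+1%:R * x j))).
  apply: ler_prod => j _; rewrite addr_ge0 ?mulr_ge0 //= addrC.
  exact: expR_ge1Dx.
rewrite -expR_sum ler_expR -mulr_sumr -[leRHS]mulr1.
by rewrite ler_wpM2l.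
Qed.

Lemma card_hit_set_fiber (n q : nat) (A : {set 'I_n}) :
  (#|[pred f : {ffun 'I_q -> 'I_n * 'I_n} | hit_set f == A]| <= #|A| ^ q.*2)%N.
Proof.
have -> : (#|A| ^ q.*2 = #|@ffun_on_mem 'I_q _ (mem (finset.setX A A))|)%N.
  by rewrite card_ffun_on cardsX card_ord -mul2n expnM mulnn.
apply: subset_leq_card; apply/fintype.subsetP => f; rewrite inE => /eqP <-.
apply/ffun_onP => t; rewrite !inE /multiplicity.
rewrite [X in (0 < X)%N && _](bigD1 t) //= [X in _ && (0 < X)%N](bigD1 t) //=.
by rewrite !eqxx addnS.
Qed.

(** The moment is split according to the hit set, of which there are
    [l ^ (2 q)] index sequences at most when it has [l] elements. *)
Lemma row_moment_le (R : realType) (n q : nat) (rho nu : R) (y : 'I_n -> R) :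
  (0 < q)%N -> 0 <= rho -> (forall j, 0 <= y j <= nu) -> \sum_j y j ^+ 2 <= 1 ->
  row_moment rho y q <=
  \sum_(2 <= l < q.+1) rho ^+ l * nu ^+ (q - l).*2 *
     (l%:R ^+ q.*2 * (expR 1 / l%:R) ^+ l).
Proof.
move=> q0 rho0 y0nu ysum; rewrite row_moment_expand.
have y2 j : 0 <= y j ^+ 2 by rewrite sqr_ge0.
pose h (A : {set 'I_n}) : R :=
  rho ^+ #|A| * (\prod_(j in A) y j ^+ 2) * nu ^+ (q - #|A|).*2.
have h0 (A : {set 'I_n}) : 0 <= h A.
  rewrite mulr_ge0 ?(@exprn_even_ge0 _ _ nu) ?odd_double //.
  by rewrite mulr_ge0 ?exprn_ge0 ?prodr_ge0.
apply: (@le_trans _ _ (\sum_(f : {ffun 'I_q -> 'I_n * 'I_n})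
   (2 <= #|hit_set f| <= q)%N%:R * h (hit_set f))).
  by apply: ler_sum => f _; apply: chaos_term_le.
apply: (@le_trans _ _ (\sum_(A : {set 'I_n} | (2 <= #|A| <= q)%N)
   #|A|%:R ^+ q.*2 * h A)).
  rewrite (partition_big (@hit_set n q) predT) // [leRHS]big_mkcond.
  apply: ler_sum => A _.
  rewrite (eq_bigr (fun=> (2 <= #|A| <= q)%N%:R * h A)); last by move=> f /eqP ->.
  rewrite sumr_const -[_ *+ #|_|]mulr_natl.
  case: ifP => [/andP[A2 _]|_]; last by rewrite mul0r mulr0.
  by rewrite mul1r ler_wpM2r ?h0 // -natrX ler_nat card_hit_set_fiber.
rewrite (partition_big (fun A : {set 'I_n} => inord #|A| : 'I_q.+1)
  (fun l => (2 <= l)%N)) /=; last first.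
  by move=> A /andP[A2 Aq]; rewrite inordK.
rewrite big_geq_mkord; apply: ler_sum => l l2.
rewrite (eq_bigl (fun A : {set 'I_n} => #|A| == l)); last first.
  move=> A; apply/andP/eqP => [[/andP[A2 Aq] /eqP <-]|Al]; first by rewrite inordK.
  rewrite Al l2 -ltnS ltn_ord; split=> //.
  by apply/eqP/val_inj; rewrite /= inordK.
rewrite (eq_bigr (fun A : {set 'I_n} => (rho ^+ l * nu ^+ (q - l).*2) *
   (l%:R ^+ q.*2 * \prod_(j in A) y j ^+ 2))); last first.
  by move=> A /eqP Al; rewrite /h Al; ring.
rewrite -!mulr_sumr.
rewrite ler_wpM2l ?mulr_ge0 ?(@exprn_even_ge0 _ _ nu) ?odd_double ?exprn_ge0 //.
by rewrite ler_wpM2l ?exprn_ge0 // sum_prod_subsets_le.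
Qed.

(** * The generating series of one row *)

Lemma expR1_le3 (R : realType) : expR 1 <= 3 :> R.
Proof.
have h : expR (1 / 6) <= 6 / 5 :> R.
  have := expR_ge1Dx (- (1 / 6) : R); rewrite expRN => h.
  rewrite -[expR _]invrK -[6 / 5]invrK lef_pV2 ?posrE ?invr_gt0 ?expR_gt0 //.
  by apply: le_trans h; lra.
have -> : expR 1 = expR (1 / 6) ^+ 6 :> R.
  by rewrite -expRM_natl; congr expR; field.
apply: (@le_trans _ _ ((6 / 5) ^+ 6)); last by lra.
by rewrite lerXn2r ?nnegrE ?expR_ge0.
Qed.

Lemma sum_half_pow_le (R : realFieldType) (N : nat) :
  \sum_(0 <= i < N) (1 / 2 : R) ^+ i <= 2.
Proof.
suff -> : \sum_(0 <= i < N) (1 / 2 : R) ^+ i = 2 - 2 * (1 / 2) ^+ N.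
  by rewrite lerBlDr lerDl mulr_ge0 // exprn_ge0.
elim: N => [|N IH]; first by rewrite big_geq // expr0; ring.
by rewrite big_nat_recr //= IH exprS; field.
Qed.

Lemma exp_partial_sum_le (R : realType) (x : R) (N : nat) :
  0 <= x -> \sum_(0 <= a < N) x ^+ a / a`!%:R <= expR x.
Proof.
move=> x0.
apply: (@nondecreasing_cvgn_le R (series (exp_coeff x))); last exact: is_cvg_series_exp_coeff.
apply/nondecreasing_seqP => k; rewrite /series /= big_nat_recr //= lerDl.
by rewrite /exp_coeff /= divr_ge0 // exprn_ge0.
Qed.

Lemma pow_le_fact_exp (R : realType) (n : nat) :
  n%:R ^+ n <= n`!%:R * expR 1 ^+ n :> R.
Proof.
rewrite -expRM_natl mulr1; case: n => [|n]; first by rewrite expr0 fact0 mul1r expR0.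
rewrite -ler_pdivrMl ?ltr0n ?fact_gt0 // mulrC.
apply: le_trans (expR_ge1Dxn n (ler0n _ _)).
by rewrite lerDr.
Qed.

Lemma fact_le_pow (a q : nat) : (a <= q)%N -> (a`! <= q ^ a)%N.
Proof.
elim: a => [|a IH] aq; first by rewrite expn0.
by rewrite factS expnS leq_mul // IH // ltnW.
Qed.

(** Uses [1 / q! <= (e / q) ^ q] for [q = l + a] and then
    [(l / q) ^ l <= 1]. *)
Lemma chaos_weight_le (R : realType) (lam rho nu : R) (l a : nat) :
  (0 < l)%N -> 0 <= lam -> 0 <= rho ->
  lam ^+ (l + a) / (l + a)`!%:R *
    (rho ^+ l * nu ^+ a.*2 * (l%:R ^+ (l + a).*2 * (expR 1 / l%:R) ^+ l))
  <= (expR 1 ^+ 2 * (lam * rho)) ^+ l *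
     ((expR 1 * lam * nu ^+ 2 * l%:R ^+ 2) ^+ a / (l + a)%:R ^+ a).
Proof.
move=> l0 lam0 rho0; set q := (l + a)%N; set e := expR 1.
have e0 : 0 < e :> R by exact: expR_gt0.
have q0 : 0 < q%:R :> R by rewrite ltr0n addn_gt0 l0.
have lr0 : 0 < l%:R :> R by rewrite ltr0n.
have inv_fact : (q`!%:R)^-1 <= e ^+ q / q%:R ^+ q :> R.
  rewrite ler_pdivlMr ?exprn_gt0 // mulrC ler_pdivrMr ?ltr0n ?fact_gt0 // mulrC.
  exact: pow_le_fact_exp.
have X0 : 0 <= lam ^+ q * (rho ^+ l * nu ^+ a.*2 * (l%:R ^+ q.*2 * (e / l%:R) ^+ l)).
  have nu0 : 0 <= nu ^+ a.*2 by rewrite exprn_even_ge0 // odd_double.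
  apply: mulr_ge0; first exact: exprn_ge0.
  apply: mulr_ge0; first by rewrite mulr_ge0 // exprn_ge0.
  by rewrite mulr_ge0 ?exprn_ge0 // ltW // divr_gt0.
rewrite mulrAC; apply: le_trans (ler_wpM2l X0 inv_fact) _.
have -> : lam ^+ q * (rho ^+ l * nu ^+ a.*2 * (l%:R ^+ q.*2 * (e / l%:R) ^+ l)) *
    (e ^+ q / q%:R ^+ q) = (e ^+ 2 * (lam * rho)) ^+ l *
     ((e * lam * nu ^+ 2 * l%:R ^+ 2) ^+ a / q%:R ^+ a) * (l%:R / q%:R) ^+ l.
  rewrite expr_div_n [(l%:R / _) ^+ l]expr_div_n !exprMn /q -!addnn !exprD.
  by field; rewrite !expf_neq0 // gt_eqF.
rewrite ler_piMr //; last first.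
  by rewrite exprn_ile1 ?divr_ge0 // ?ler_pdivrMr ?mul1r ?ler_nat ?leq_addr.
have e2 : 0 <= e by exact: ltW.
apply: mulr_ge0; first by rewrite exprn_ge0 // mulr_ge0 ?mulr_ge0 ?exprn_ge0.
rewrite divr_ge0 ?exprn_ge0 // mulr_ge0 ?sqr_ge0 //.
by rewrite mulr_ge0 ?sqr_ge0 // mulr_ge0.
Qed.

Lemma sum_sqr_le_sqr_sum (R : realType) (N : nat) (x : nat -> R) :
  (forall a, 0 <= x a) ->
  \sum_(0 <= a < N) x a ^+ 2 <= (\sum_(0 <= a < N) x a) ^+ 2.
Proof.
move=> x0; elim: N => [|N IH]; first by rewrite !big_geq // expr0n.
rewrite !big_nat_recr //= sqrrD -addrA lerD //.
by rewrite lerDr mulrn_wge0 // mulr_ge0 // sumr_ge0.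
Qed.

(** The denominator [(2 + a) ^ a] exceeds [a!], which leaves an exponential
    series. *)
Lemma pair_hit_sum_le (R : realType) (c : R) (N : nat) : 0 <= c ->
  \sum_(0 <= a < N) (c * 2%:R ^+ 2) ^+ a / (2 + a)%:R ^+ a <= expR (4 * c).
Proof.
move=> c0.
have -> : c * 2%:R ^+ 2 = 4 * c :> R by ring.
have c4 : 0 <= 4 * c by rewrite mulr_ge0.
apply: le_trans (exp_partial_sum_le N c4).
apply: ler_sum => a _; rewrite ler_wpM2l ?exprn_ge0 //.
rewrite lef_pV2 ?posrE ?exprn_gt0 ?ltr0n ?fact_gt0 //.
by rewrite -natrX ler_nat fact_le_pow // leq_addl.
Qed.

(** Both [p ^ a] and [(l + a) ^ a] exceed [a!] as long as [l + a <= p], so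
    the [a]-th term is at most the square of the [a]-th term of the series of
    [expR (g * l)].  This is where the truncation at order [p] is used. *)
Lemma many_hit_sum_le (R : realType) (c g : R) (l p : nat) :
  (0 < l)%N -> (l <= p)%N -> 0 <= c -> 0 <= g -> c <= g ^+ 2 / p%:R ->
  \sum_(0 <= a < p.+1 - l) (c * l%:R ^+ 2) ^+ a / (l + a)%:R ^+ a
  <= expR (g * l%:R) ^+ 2.
Proof.
move=> l0 lp c0 g0 cg.
have p0 : 0 < p%:R :> R by rewrite ltr0n (leq_trans l0).
have gl0 : 0 <= g * l%:R by rewrite mulr_ge0.
apply: (@le_trans _ _ (\sum_(0 <= a < p.+1 - l) ((g * l%:R) ^+ a / a`!%:R) ^+ 2)).
  rewrite big_nat [leRHS]big_nat; apply: ler_sum => a /andP[_ ap].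
  have la : (l + a <= p)%N by move: ap; rewrite ltn_subRL ltnS.
  have la0 : 0 < (l + a)%:R :> R by rewrite ltr0n addn_gt0 l0.
  have f0 : 0 < a`!%:R :> R by rewrite ltr0n fact_gt0.
  apply: (@le_trans _ _ ((g ^+ 2 / p%:R * l%:R ^+ 2) ^+ a / (l + a)%:R ^+ a)).
    rewrite ler_wpM2r ?invr_ge0 ?exprn_ge0 //.
    rewrite lerXn2r ?nnegrE ?mulr_ge0 ?divr_ge0 ?sqr_ge0 //.
    by rewrite ler_wpM2r ?sqr_ge0.
  have -> : (g ^+ 2 / p%:R * l%:R ^+ 2) ^+ a / (l + a)%:R ^+ a =
      ((g * l%:R) ^+ a) ^+ 2 * (p%:R ^+ a * (l + a)%:R ^+ a)^-1.
    rewrite -exprMn -exprM mulnC exprM -exprVn -exprVn -!exprMn; congr (_ ^+ _).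
    by field; rewrite -natrD !gt_eqF.
  rewrite [leRHS]expr_div_n ler_wpM2l ?sqr_ge0 //.
  rewrite lef_pV2 ?posrE ?mulr_gt0 ?exprn_gt0 // expr2 ler_pM //.
    by rewrite -natrX ler_nat fact_le_pow // (leq_trans _ la) // leq_addl.
  by rewrite -natrX ler_nat fact_le_pow // leq_addl.
apply: le_trans (sum_sqr_le_sqr_sum _ _) _.
  by move=> a; rewrite divr_ge0 ?exprn_ge0.
rewrite lerXn2r ?nnegrE ?expR_ge0 ?exp_partial_sum_le //.
by apply: sumr_ge0 => a _; rewrite divr_ge0 ?exprn_ge0.
Qed.

(** After exchanging the sums over the order [q] and the number [l] of
    columns hit, the [l]-th part is at most [p / (2 m) * 2 ^ (2 - l)]: for [l = 2]
    by [pair_hit_sum_le], for [l >= 3] by [many_hit_sum_le], where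
    [expR (b l / 6) ^ 2 <= expR b ^ (l - 2)] because [l <= 3 (l - 2)]. *)
Lemma row_generating_le (R : realType) (n m p : nat) (lam rho nu b E : R)
    (y : 'I_n -> R) :
  let d := expR 1 ^+ 2 * (lam * rho) in
  let c := expR 1 * lam * nu ^+ 2 in
  0 <= lam -> 0 <= rho -> 0 <= b -> 1 <= E ->
  (forall j, 0 <= y j <= nu) -> \sum_j y j ^+ 2 <= 1 ->
  d ^+ 2 * E <= p%:R / m%:R / 2 -> expR (4 * c) <= E ->
  d * expR b <= 1 / 2 -> c <= (b / 6) ^+ 2 / p%:R ->
  \sum_(q < p.+1) lam ^+ q / q`!%:R * row_moment rho y q <= 1 + p%:R / m%:R.
Proof.
move=> d c lam0 rho0 b0 E1 y0nu ysum hE h4 hb hc.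
have e0 : 0 < expR 1 :> R by exact: expR_gt0.
have d0 : 0 <= d by rewrite mulr_ge0 ?sqr_ge0 // mulr_ge0.
have c0 : 0 <= c by rewrite mulr_ge0 ?sqr_ge0 // mulr_ge0 // ltW.
rewrite big_ord_recl expr0 fact0 divr1 mul1r row_moment0 lerD2l.
pose F l a : R := d ^+ l * ((c * l%:R ^+ 2) ^+ a / (l + a)%:R ^+ a).
have F0 l a : 0 <= F l a.
  by rewrite mulr_ge0 ?exprn_ge0 // divr_ge0 ?exprn_ge0 // mulr_ge0 ?sqr_ge0.
apply: (@le_trans _ _ (\sum_(q < p.+1) \sum_(2 <= l < q.+1) F l (q - l)%N)).
  rewrite [leRHS]big_ord_recl big_geq // add0r; apply: ler_sum => q _.
  have -> : lift ord0 q = q.+1 :> nat by [].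
  apply: le_trans (ler_wpM2l _ (row_moment_le _ rho0 y0nu ysum)) _ => //.
    by rewrite divr_ge0 ?exprn_ge0.
  rewrite mulr_sumr big_nat [leRHS]big_nat; apply: ler_sum => l /andP[l2 lq].
  have lqE : q.+1 = (l + (q.+1 - l))%N by rewrite subnKC.
  have := @chaos_weight_le _ lam rho nu l (q.+1 - l) (ltnW l2) lam0 rho0.
  by rewrite -lqE /F -lqE.
have -> : \sum_(q < p.+1) \sum_(2 <= l < q.+1) F l (q - l)%N =
          \sum_(2 <= l < p.+1) \sum_(0 <= a < p.+1 - l) F l a.
  rewrite -(big_mkord predT (fun q => \sum_(2 <= l < q.+1) F l (q - l)%N)).
  under eq_big_nat => q /andP[_ qp] do rewrite (big_nat_widen _ _ p.+1) //.
  rewrite (exchange_big_dep_nat predT) //=; apply: eq_big_nat => l /andP[l2 lp].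
  under [LHS]eq_bigl => q do rewrite ltnS.
  rewrite -(big_nat_widenl l 0 _ predT) // -[X in \sum_(X <= _ < _) _]add0n big_addn.
  by apply: eq_bigr => a _; rewrite addnK.
have pm0 : 0 <= p%:R / m%:R / 2 :> R by rewrite !divr_ge0.
apply: (@le_trans _ _ (\sum_(2 <= l < p.+1) (p%:R / m%:R / 2) * (1 / 2) ^+ (l - 2))).
  rewrite big_nat [leRHS]big_nat; apply: ler_sum => l /andP[l2 lp].
  rewrite /F -mulr_sumr; have [->|l3] := eqVneq l 2.
    rewrite subnn expr0 mulr1; apply: le_trans hE.
    rewrite ler_wpM2l ?exprn_ge0 //; apply: le_trans h4; exact: pair_hit_sum_le.
  have {}l3 : (2 < l)%N by rewrite ltn_neqAle eq_sym l3.
  have g0 : 0 <= b / 6 by rewrite divr_ge0.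
  have := @many_hit_sum_le _ c (b / 6) l p (ltnW l2) lp c0 g0 hc.
  move/(ler_wpM2l (exprn_ge0 l d0)) => /le_trans; apply.
  have -> : d ^+ l = d ^+ 2 * d ^+ (l - 2) by rewrite -exprD subnKC.
  rewrite -[leLHS]mulrA; apply: ler_pM; rewrite ?mulr_ge0 ?exprn_ge0 ?expR_ge0 //.
    apply: le_trans hE; rewrite ler_peMr ?exprn_ge0 //.
  apply: (@le_trans _ _ ((d * expR b) ^+ (l - 2))); last first.
    by rewrite lerXn2r ?nnegrE ?mulr_ge0 ?expR_ge0.
  rewrite [leRHS]exprMn ler_wpM2l ?exprn_ge0 // -!expRM_natl ler_expR natrB //.
  have : 3 <= l%:R :> R by rewrite ler_nat.
  by nra.
rewrite -mulr_sumr -[leRHS](divfK (_ : 2 != 0)) // ler_wpM2l //.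
rewrite -{1}[2%N]add0n big_addn.
apply: le_trans (sum_half_pow_le R (p.+1 - 2)).
by apply: ler_sum => i _; rewrite addnK.
Qed.

(** * One column of a hashing matrix *)

(** An entry of a column of the hashing matrix before division by
    [Num.sqrt s]. *)
Definition col_entry (R : realType) (m s : nat) (x : column_sample m s)
    (k : 'I_m) : R := \sum_(t < s | x.1 t == k) (-1) ^+ (x.2 t : bool).

Definition col_wt (R : realType) (m s : nat) (x : column_sample m s) : R :=
  if x \in admissible_samples m s then #|admissible_samples m s|%:R^-1 else 0.

Definition flip_row (m s : nat) (k : 'I_m) (x : column_sample m s) :
    column_sample m s := (x.1, [ffun t => x.2 t (+) (x.1 t == k)]).

Lemma flip_rowK (m s : nat) (k : 'I_m) : involutive (@flip_row m s k).
Proof.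
move=> [i b]; rewrite /flip_row /=; congr (_, _).
by apply/ffunP => t; rewrite !ffunE addbK.
Qed.

Lemma col_entry_flip (R : realType) (m s : nat) (k k' : 'I_m)
    (x : column_sample m s) :
  col_entry R (flip_row k x) k' = (-1) ^+ (k' == k) * col_entry R x k'.
Proof.
rewrite /col_entry mulr_sumr; apply: eq_bigr => t /= /eqP <-.
by rewrite ffunE signr_addb mulrC.
Qed.

(** Flipping the signs of the samples that land in row [k] preserves the law
    and changes the sign of the monomial. *)
Lemma sum_col_odd (R : realType) (m s : nat) (e : 'I_m -> nat) (k : 'I_m) :
  odd (e k) -> \sum_x col_wt R x * \prod_k' col_entry R (s := s) x k' ^+ e k' = 0.
Proof.
move=> oe; set S := (X in X = 0).
suff : S = - S by move=> h; lra.
rewrite {1}/S (reindex_inj (inv_inj (@flip_rowK m s k))) /= -sumrN.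
apply: eq_bigr => x _.
have -> : col_wt R (flip_row k x) = col_wt R x.
  by rewrite /col_wt /admissible_samples !inE.
rewrite -mulrN; congr (_ * _).
under eq_bigr => k' _ do rewrite col_entry_flip exprMn.
rewrite big_split /= (bigD1 k) //= eqxx expr1 -signr_odd oe expr1 big1; last first.
  by move=> k' /negbTE ->; rewrite expr0 expr1n.
by rewrite mulr1 mulN1r.
Qed.

Definition covering_samples (m s : nat) (A : {set 'I_m}) :
    {set column_sample m s} :=
  [set x in admissible_samples m s | A \subset codom x.1]%SET.

(** The count depends on the added row only up to a transposition of rows. *)
Lemma card_covering_perm (m s : nat) (A : {set 'I_m}) (k k' : 'I_m) :
  k \notin A -> k' \notin A ->
  (#|covering_samples s (k |: A)| <= #|covering_samples s (k' |: A)|)%N.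
Proof.
move=> kA kA'.
pose T (x : column_sample m s) : column_sample m s :=
  ([ffun t => tperm k k' (x.1 t)], x.2).
have TK : involutive T.
  move=> [i b]; congr (_, _); apply/ffunP => t.
  by rewrite !ffunE tpermK.
rewrite -(card_imset _ (inv_inj TK)).
apply: subset_leq_card; apply/fintype.subsetP => _ /imsetP[x xP ->].
move: xP; rewrite !inE => /andP[/injectiveP xi /fintype.subsetP xc].
apply/andP; split.
  by apply/injectiveP => t t'; rewrite !ffunE => /perm_inj /xi.
apply/fintype.subsetP => j jA.
have /xc /codomP[t jt] : tperm k k' j \in k |: A.
  move: jA; rewrite !inE => /orP[/eqP ->|jA]; first by rewrite tpermR eqxx.
  rewrite tpermD ?jA ?orbT //; last by apply: contraNneq kA' => ->.
  by apply: contraNneq kA => ->.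
by apply/codomP; exists t; rewrite ffunE -jt tpermK.
Qed.

Lemma setU1_subset_seq (T : finType) (k : T) (A : {set T}) (q : seq T) :
  (k |: A \subset q) = (k \in q) && (A \subset q).
Proof.
apply/fintype.subsetP/andP => [h|[kq /fintype.subsetP Aq] j].
  split; first by apply: h; rewrite !inE eqxx.
  by apply/fintype.subsetP => j jA; apply: h; rewrite !inE jA orbT.
by rewrite !inE => /orP[/eqP ->|/Aq].
Qed.

(** Double counting of the pairs formed by a sample covering [A] and a
    further row that it covers; all rows outside [A] contribute equally by
    [card_covering_perm]. *)
Lemma card_covering_step (m s : nat) (A : {set 'I_m}) (k : 'I_m) :
  k \notin A ->
  ((m - #|A|) * #|covering_samples s (k |: A)| =
   (s - #|A|) * #|covering_samples s A|)%N.
Proof.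
move=> kA.
have -> : ((s - #|A|) * #|covering_samples s A| =
   \sum_(k' in ~: A) #|covering_samples s (k' |: A)|)%N.
  under eq_bigr => k' _ do rewrite -sum1_card big_mkcond /=.
  rewrite exchange_big /= mulnC -sum_nat_const [LHS]big_mkcond /=.
  apply: eq_bigr => x _; case: ifP => [xA|xA]; last first.
    rewrite big1 // => k' _; case: ifP => //.
    rewrite !inE setU1_subset_seq andbCA => /andP[_ xA'].
    by move: xA; rewrite !inE xA'.
  move: xA; rewrite !inE => /andP[xi xA].
  rewrite -big_mkcondr /= sum1_card.
  have cx : #|codom x.1| = s by rewrite card_codom ?card_ord //; apply/injectiveP.
  have -> : (s - #|A| = #|[set j in codom x.1]%SET :\: A|)%N.
    rewrite finset.cardsD (finset.setIidPr _) ?finset.cardsE ?cx //.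
    by apply/fintype.subsetP => j /(fintype.subsetP xA); rewrite inE.
  apply: eq_card => j; rewrite [RHS]unfold_in /= !inE xi /= setU1_subset_seq.
  by rewrite xA andbT.
rewrite (eq_bigr (fun=> #|covering_samples s (k |: A)|)); last first.
  move=> k'; rewrite inE => kA'.
  by apply/eqP; rewrite eqn_leq !card_covering_perm.
by rewrite sum_nat_const (finset.cardsCs (~: A)) finset.setCK card_ord.
Qed.

(** In probabilistic terms, the chance that a random sample covers [A] is
    at most [(s / m) ^ #|A|]: covering one more row costs a factor
    [(s - a) / (m - a) <= s / m]. *)
Lemma card_covering_le (m s : nat) (A : {set 'I_m}) : (s <= m)%N ->
  (m ^ #|A| * #|covering_samples s A| <= s ^ #|A| * #|admissible_samples m s|)%N.
Proof.
move=> sm.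
elim: {A}_.+1 {-2}A (ltnSn #|A|) => // N IH A AN.
have [->|[k kA]] := finset.set_0Vmem A.
  rewrite finset.cards0 !expn0 !mul1n; apply: subset_leq_card.
  by apply/fintype.subsetP => x; rewrite inE => /andP[].
have kA' : k \notin A :\ k by rewrite !inE eqxx.
have cA : #|A| = #|A :\ k|.+1 by rewrite (finset.cardsD1 k A) kA.
have := IH (A :\ k); rewrite -ltnS -cA => /(_ AN) {}IH.
have := card_covering_step s kA'; rewrite finset.setD1K // => step.
set a := #|A :\ k| in cA IH step.
have am : (a < m)%N by rewrite -cA -[X in (_ <= X)%N]card_ord max_card.
have ma : (0 < m - a)%N by rewrite subn_gt0.
rewrite cA !expnS.
rewrite -(leq_pmul2l ma).
have -> : ((m - a) * (m * m ^ a * #|covering_samples s A|) =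
  m * (s - a) * (m ^ a * #|covering_samples s (A :\ k)|))%N.
  rewrite -!mulnA; rewrite (mulnCA (m - a)%N); congr (_ * _)%N.
  by rewrite (mulnCA (m - a)%N) step; lia.
have -> : ((m - a) * (s * s ^ a * #|admissible_samples m s|) =
  s * (m - a) * (s ^ a * #|admissible_samples m s|))%N by lia.
apply: leq_mul => //; rewrite !mulnBr mulnC leq_sub2l //.
by rewrite leq_mul2r sm orbT.
Qed.

Lemma col_entry_notin (R : realType) (m s : nat) (x : column_sample m s)
    (k : 'I_m) : k \notin codom x.1 -> col_entry R x k = 0.
Proof.
move=> kx; rewrite /col_entry big1 // => t /eqP tk.
by move: kx; rewrite -tk codom_f.
Qed.

Lemma norm_col_entry (R : realType) (m s : nat) (x : column_sample m s)
    (t : 'I_s) : injective x.1 -> `|col_entry R x (x.1 t)| = 1.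
Proof.
move=> xi; rewrite /col_entry (big_pred1 t) ?normr_sign // => t'.
by rewrite /= (inj_eq xi).
Qed.

Lemma col_entry_covered (R : realType) (m s : nat) (x : column_sample m s)
    (e : 'I_m -> nat) :
  injective x.1 ->
  `|\prod_k col_entry R x k ^+ e k| <=
  ([set k | (0 < e k)%N]%SET \subset codom x.1)%:R.
Proof.
move=> xi; case: (boolP (_ \subset _)) => [_|/subsetPn[k]].
  rewrite normr_prod prodr_ile1 // => k _; rewrite normrX exprn_ge0 //=.
  rewrite exprn_ile1 //; case: (boolP (k \in codom x.1)) => [/codomP[t ->]|kx].
    by rewrite norm_col_entry.
  by rewrite col_entry_notin // normr0.
rewrite inE => ek kx; rewrite (bigD1 k) //= col_entry_notin //.
by rewrite expr0n -[e k == 0%N]negbK -lt0n ek mul0r normr0.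
Qed.

Lemma prod_sign_moment_even (R : realType) (m : nat) (rho : R) (e : 'I_m -> nat) :
  (forall k, ~~ odd (e k)) ->
  \prod_k sign_moment rho (e k) = rho ^+ #|[set k | (0 < e k)%N]%SET|.
Proof.
move=> ev; rewrite (bigID (fun k => 0 < e k)%N) /= [X in _ * X]big1 ?mulr1.
  rewrite -prodr_const; apply: eq_big => k; first by rewrite inE.
  by rewrite /sign_moment (negbTE (ev k)) lt0n => /negbTE ->.
by move=> k; rewrite -eqn0Ngt /sign_moment => ->.
Qed.

(** Odd exponents are handled by [sum_col_odd]; otherwise a monomial has
    absolute value at most 1 and vanishes unless the sample covers all the rows
    that occur, which is [card_covering_le]. *)
Lemma col_monomial_le (R : realType) (m s : nat) (e : 'I_m -> nat) :
  (s <= m)%N ->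
  `|\sum_x col_wt R x * \prod_k col_entry R (s := s) x k ^+ e k|
  <= \prod_k sign_moment (s%:R / m%:R) (e k).
Proof.
move=> sm; have [/forallP ev|/forallPn[k]] := boolP [forall k, ~~ odd (e k)];
  last first.
  rewrite negbK => oe; rewrite (sum_col_odd R s oe) normr0.
  by apply: prodr_ge0 => k' _; rewrite sign_moment_ge0 // divr_ge0.
rewrite prod_sign_moment_even //; set A := [set k | _]%SET.
set N := #|admissible_samples m s|.
have [N0|N0] := posnP N.
  rewrite big1 ?normr0 ?exprn_ge0 ?divr_ge0 // => x _.
  by rewrite /col_wt -/N N0 invr0 if_same mul0r.
apply: (@le_trans _ _ (\sum_(x in admissible_samples m s)
    N%:R^-1 * (A \subset codom x.1)%:R)).
  rewrite [leRHS]big_mkcond; apply: le_trans (ler_norm_sum _ _ _) _.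
  apply: ler_sum => x _; rewrite normrM /col_wt.
  case: ifP => [|_]; last by rewrite normr0 mul0r.
  rewrite inE => /injectiveP xi; rewrite ger0_norm ?invr_ge0 //.
  by rewrite ler_wpM2l ?invr_ge0 // col_entry_covered.
rewrite -mulr_sumr.
have -> : \sum_(x in admissible_samples m s) (A \subset codom x.1)%:R
     = #|covering_samples s A|%:R :> R.
  rewrite -sum1_card natr_sum big_mkcond [RHS]big_mkcond /=.
  apply: eq_bigr => x _; rewrite [in RHS]inE.
  by case: (x \in admissible_samples m s) => //=; case: (A \subset _).
rewrite ler_pdivrMl ?ltr0n //.
have [->|A0] := eqVneq A finset.set0.
  rewrite finset.cards0 expr0 mulr1 ler_nat; apply: subset_leq_card.
  by apply/fintype.subsetP => x; rewrite inE => /andP[].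
have m0 : (0 < m)%N.
  case: (finset.set_0Vmem A) A0 => [->|[[k km] _] _]; first by rewrite eqxx.
  exact: leq_trans km.
rewrite expr_div_n mulrA ler_pdivlMr ?exprn_gt0 ?ltr0n //.
by rewrite -!natrX -!natrM ler_nat mulnC [X in (_ <= X)%N]mulnC card_covering_le.
Qed.

(** * Comparison of hashing with independent entries *)

Definition hash_wt (R : realType) (m n s : nat)
    (X : {ffun 'I_n -> column_sample m s}) : R := \prod_j col_wt R (X j).

Lemma hash_monomial_le (R : realType) (m n s : nat) (e : 'I_m * 'I_n -> nat) :
  (s <= m)%N ->
  `|\sum_X hash_wt R X *
      \prod_x col_entry R (s := s) (X x.2) x.1 ^+ e x|
  <= \prod_x sign_moment (s%:R / m%:R) (e x).
Proof.
move=> sm.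
have pairE (F : 'I_m * 'I_n -> R) : \prod_x F x = \prod_j \prod_k F (k, j).
  by rewrite exchange_big pair_bigA; apply: eq_bigr => -[].
rewrite [leRHS]pairE; under [X in `|X|]eq_bigr => X _ do
  rewrite (pairE (fun x => col_entry R (X x.2) x.1 ^+ e x)) /=.
rewrite (product_expectation (fun=> @col_wt R m s)
  (fun j x => \prod_k col_entry R x k ^+ e (k, j))) normr_prod.
by apply: ler_prod => j _; rewrite normr_ge0 col_monomial_le.
Qed.

Definition hash_chaos (R : realType) (m n s : nat) (x : 'I_n -> R)
    (X : {ffun 'I_n -> column_sample m s}) : R :=
  \sum_(g : 'I_m * ('I_n * 'I_n)) offdiag_coef x g.2 *
    (col_entry R (X g.2.1) g.1 * col_entry R (X g.2.2) g.1).

Lemma hash_chaos_moment_le (R : realType) (m n s p : nat) (x : 'I_n -> R) :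
  (s <= m)%N ->
  \sum_X hash_wt R X * hash_chaos (m := m) (s := s) x X ^+ p <=
  \sum_(B : {ffun 'I_m -> {ffun 'I_n -> option bool}})
     (\prod_k row_wt (s%:R / m%:R) (B k)) *
     (\sum_k row_chaos (fun j => `|x j|) (B k)) ^+ p.
Proof.
move=> sm.
pose u (g : 'I_m * ('I_n * 'I_n)) := (g.1, g.2.1).
pose v (g : 'I_m * ('I_n * 'I_n)) := (g.1, g.2.2).
have := @moment_domination R p _ _ _ _ u v (fun g => offdiag_coef x g.2)
  (@hash_wt R m n s) (fun X g => col_entry R (X g.2) g.1)
  (fun B : {ffun 'I_m -> {ffun 'I_n -> option bool}} =>
     \prod_k row_wt (s%:R / m%:R) (B k))
  (fun B g => sign_val R (B g.1 g.2)).
move=> /(_ _)/le_trans; apply.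
  by move=> e; rewrite matrix_monomial hash_monomial_le.
apply: ler_sum => B _; rewrite le_eqVlt; apply/orP; left; apply/eqP.
congr (_ * _ ^+ _).
rewrite /row_chaos (pair_bigA _ (fun k g => offdiag_coef (fun j => `|x j|) g *
  (sign_val R (B k g.1) * sign_val R (B k g.2)))) /=.
apply: eq_bigr => g _; congr (_ * _).
by rewrite /offdiag_coef !normrM normr_nat.
Qed.

(** The series of a row is at most [1 + p / m <= expR (p / m)], and there
    are [m] rows. *)
Lemma hash_chaos_moment_exp (R : realType) (m n s p : nat) (lam nu b E : R)
    (x : 'I_n -> R) :
  let rho : R := s%:R / m%:R in
  let d := expR 1 ^+ 2 * (lam * rho) in
  let c := expR 1 * lam * nu ^+ 2 in
  (0 < m)%N -> (s <= m)%N -> 0 <= lam -> 0 <= b -> 1 <= E ->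
  (forall j, `|x j| <= nu) -> \sum_j x j ^+ 2 <= 1 ->
  d ^+ 2 * E <= p%:R / m%:R / 2 -> expR (4 * c) <= E ->
  d * expR b <= 1 / 2 -> c <= (b / 6) ^+ 2 / p%:R ->
  lam ^+ p / p`!%:R * (\sum_X hash_wt R X * hash_chaos (m := m) (s := s) x X ^+ p)
  <= expR 1 ^+ p.
Proof.
move=> rho d c m0 sm lam0 b0 E1 xnu xsum hE h4 hb hc.
have rho0 : 0 <= rho by rewrite divr_ge0.
have P0 : 0 <= lam ^+ p / p`!%:R by rewrite divr_ge0 ?exprn_ge0.
apply: le_trans (ler_wpM2l P0 (hash_chaos_moment_le p x sm)) _.
have y0 q : 0 <= row_moment rho (fun j => `|x j|) q by apply: row_moment_ge0.
apply: le_trans (iid_sum_moment m p y0 lam0) _.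
have := @row_generating_le R n m p lam rho nu b E (fun j => `|x j|) lam0 rho0 b0 E1.
move=> /(_ _ _ hE h4 hb hc) G.
have {}G := le_trans (G _ _) (expR_ge1Dx _).
apply: (@le_trans _ _ (expR (p%:R / m%:R) ^+ m)).
  rewrite lerXn2r ?nnegrE ?expR_ge0 //.
    by apply: sumr_ge0 => q _; rewrite mulr_ge0 ?y0 // divr_ge0 ?exprn_ge0.
  apply: G => [j|]; first by rewrite normr_ge0 xnu.
  by rewrite (eq_bigr (fun j => x j ^+ 2)) // => j _; rewrite real_normK ?num_real.
by rewrite -!expRM_natl mulr1 mulrC divfK // gt_eqF // ltr0n.
Qed.

(** * A net for quadratic forms *)

Definition sqnorm (R : realType) (r : nat) (u : 'I_r -> R) : R :=
  \sum_i u i ^+ 2.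

Definition quad_form (R : realType) (r : nat) (M : 'I_r -> 'I_r -> R)
    (u : 'I_r -> R) : R := \sum_i \sum_j M i j * (u i * u j).

Definition grid_type (r : nat) : finType :=
  {ffun 'I_r -> bool * 'I_(64 * r).+1}.

(** The grid has mesh [1 / (8 sqrt r)] in each coordinate, so rounding towards
    zero moves a vector by at most [1 / 8] in norm and does not lengthen it. *)
Definition grid_vec (R : realType) (r : nat) (z : grid_type r) (i : 'I_r) : R :=
  (-1) ^+ ((z i).1 : bool) * (z i).2%:R / (8 * Num.sqrt r%:R).

Definition grid_net (r : nat) : {set grid_type r} :=
  [set z : grid_type r | \sum_i (z i).2 ^ 2 <= 64 * r]%N%SET.

Lemma sqnorm_ge0 (R : realType) (r : nat) (u : 'I_r -> R) : 0 <= sqnorm u.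
Proof. by apply: sumr_ge0 => i _; rewrite sqr_ge0. Qed.

Lemma leq_self_sqr (k : nat) : (k <= k ^ 2)%N.
Proof. by case: k => // k; rewrite -mulnn leq_pmulr. Qed.

(** The integer points [k] of the ball [\sum_i k i ^ 2 <= 64 r] satisfy
    [1 <= 2 ^ (64 r) * \prod_i 2 ^ (- k i)], and the sum of the right-hand side
    over all points factors into geometric series, each at most 4 when the two
    signs are counted. *)
Lemma card_grid_net (r : nat) : (#|grid_net r| <= 2 ^ (66 * r))%N.
Proof.
pose R : realFieldType := rat.
rewrite -(ler_nat R).
apply: (@le_trans _ _ (\sum_(z in grid_net r)
   2 ^+ (64 * r) * \prod_i (1 / 2 : R) ^+ (z i).2)).
  rewrite -sum1_card natr_sum; apply: ler_sum => z; rewrite inE => zr.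
  rewrite prodrXr expr_div_n expr1n mulrA mulr1 ler_pdivlMr ?exprn_gt0 // mul1r.
  rewrite ler_weXn2l ?ler1n //; apply: leq_trans zr; apply: leq_sum => i _.
  exact: leq_self_sqr.
apply: (@le_trans _ _ (\sum_(z : grid_type r)
   2 ^+ (64 * r) * \prod_i (1 / 2 : R) ^+ (z i).2)).
  rewrite [leRHS](bigID (mem (grid_net r))) /= lerDl sumr_ge0 // => z _.
  by rewrite mulr_ge0 ?exprn_ge0 ?prodr_ge0 // => i _; rewrite exprn_ge0.
rewrite -mulr_sumr -(bigA_distr_bigA (fun _ (x : bool * 'I_(64 * r).+1) =>
  (1 / 2 : R) ^+ x.2)) /=.
rewrite prodr_const card_ord.
have -> : (2 ^ (66 * r))%:R = 2 ^+ (64 * r) * 4 ^+ r :> R.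
  rewrite natrX (_ : 66 * r = 64 * r + 2 * r)%N; last by lia.
  by rewrite exprD; congr (_ * _); rewrite exprM; congr (_ ^+ _).
rewrite ler_wpM2l ?exprn_ge0 // lerXn2r ?nnegrE //.
  by apply: sumr_ge0 => x _; rewrite exprn_ge0.
rewrite -(pair_bigA _ (fun _ (k : 'I_(64 * r).+1) => (1 / 2 : R) ^+ k)) /=.
rewrite sumr_const card_bool.
have := sum_half_pow_le R (64 * r).+1; rewrite big_mkord; lra.
Qed.

Lemma sqnorm_grid_net (R : realType) (r : nat) (z : grid_type r) :
  z \in grid_net r -> sqnorm (grid_vec R z) <= 1.
Proof.
rewrite inE => zr; have [r0|r0] := posnP r.
  by rewrite /sqnorm big1 // => i _; have := ltn_ord i; rewrite [X in (_ < X)%N]r0.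
have r0' : 0 < r%:R :> R by rewrite ltr0n.
rewrite /sqnorm (eq_bigr (fun i => ((z i).2 ^ 2)%:R / (64 * r%:R))); last first.
  move=> i _; rewrite /grid_vec expr_div_n exprMn sqrr_sign mul1r natrX.
  by rewrite exprMn sqr_sqrtr ?ltW //; congr (_ / (_ * _)); ring.
by rewrite -mulr_suml ler_pdivrMr ?mulr_gt0 // mul1r -natrM -natr_sum ler_nat.
Qed.

Lemma grid_net_approx (R : realType) (r : nat) (u : 'I_r -> R) :
  sqnorm u <= 1 ->
  exists2 z, z \in grid_net r & sqnorm (fun i => u i - grid_vec R z i) <= 1 / 64.
Proof.
move=> u1.
have [r0|r0] := posnP r.
  move: u u1; rewrite r0 => u _.
  exists [ffun=> (false, ord0)]; first by rewrite inE big_ord0.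
  by rewrite /sqnorm !big_ord0; lra.
set c : R := 8 * Num.sqrt r%:R.
have c0 : 0 < c by rewrite mulr_gt0 // sqrtr_gt0 ltr0n.
have c2 : c ^+ 2 = 64 * r%:R by rewrite exprMn sqr_sqrtr //; ring.
pose k i := Num.truncn (`|u i| * c).
have kP i : (k i)%:R <= `|u i| * c < (k i).+1%:R.
  by apply: truncn_itv; rewrite mulr_ge0 // ltW.
have k2 : (\sum_i k i ^ 2 <= 64 * r)%N.
  rewrite -(ler_nat R) natr_sum natrM -c2 -[leRHS]mul1r.
  apply: (@le_trans _ _ (sqnorm u * c ^+ 2)); last first.
    by rewrite ler_wpM2r // sqr_ge0.
  rewrite /sqnorm mulr_suml; apply: ler_sum => i _; have /andP[h _] := kP i.
  rewrite natrX -(real_normK (num_real (u i))) -exprMn lerXn2r ?nnegrE //.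
  by rewrite mulr_ge0 // ltW.
have kb i : (k i < (64 * r).+1)%N.
  rewrite ltnS; apply: leq_trans k2; rewrite (bigD1 i) //=.
  exact: leq_trans (leq_self_sqr _) (leq_addr _ _).
pose z : grid_type r := [ffun i => (u i < 0, Ordinal (kb i))].
have zE i : grid_vec R z i = (-1) ^+ (u i < 0)%R * ((k i)%:R / c).
  by rewrite /grid_vec ffunE /= mulrA.
have uE i : u i = (-1) ^+ (u i < 0)%R * `|u i| by rewrite mulr_sign_norm.
exists z; first by rewrite inE; under eq_bigr => i _ do rewrite ffunE.
apply: (@le_trans _ _ (\sum_(i < r) (1 / c) ^+ 2)).
  apply: ler_sum => i _; have /andP[h1 h2] := kP i.
  rewrite zE {1}(uE i) -mulrBr exprMn sqrr_sign !mul1r.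
  have d0 : 0 <= `|u i| - (k i)%:R / c by rewrite subr_ge0 ler_pdivrMr.
  rewrite lerXn2r ?nnegrE ?invr_ge0 ?(ltW c0) //.
  rewrite -(ler_pM2r c0) mulVf ?gt_eqF // mulrBl divfK ?gt_eqF //.
  by rewrite lerBlDl natr1 ltW.
rewrite sumr_const card_ord expr_div_n c2 expr1n -[_ *+ r]mulr_natr.
by rewrite le_eqVlt; apply/orP; left; apply/eqP; field; rewrite pnatr_eq0 -lt0n.
Qed.

(** The two arguments on the right have norm at most 1 when [u] and [w] are
    in the unit ball at distance at most [1 / 8], thanks to the scaling by 4. *)
Lemma quad_form_polarization (R : realType) (r : nat) (M : 'I_r -> 'I_r -> R)
    (u w : 'I_r -> R) :
  quad_form M u - quad_form M w =
  (quad_form M (fun i => 4 * (u i - w i) + (u i + w i) / 4)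
   - quad_form M (fun i => 4 * (u i - w i) - (u i + w i) / 4)) / 4.
Proof.
rewrite /quad_form -!sumrB mulr_suml; apply: eq_bigr => i _.
rewrite -!sumrB mulr_suml; apply: eq_bigr => j _.
by field.
Qed.

Lemma sqnormD_le (R : realType) (r : nat) (u w : 'I_r -> R) :
  sqnorm (fun i => u i + w i) <= 2 * (sqnorm u + sqnorm w).
Proof.
rewrite /sqnorm -big_split /= mulr_sumr; apply: ler_sum => i _.
have := sqr_ge0 (u i - w i); nra.
Qed.

Lemma sqnormZ (R : realType) (r : nat) (u : 'I_r -> R) (a : R) :
  sqnorm (fun i => a * u i) = a ^+ 2 * sqnorm u.
Proof. by rewrite /sqnorm mulr_sumr; apply: eq_bigr => i _; rewrite exprMn. Qed.

Lemma quad_formZ (R : realType) (r : nat) (M : 'I_r -> 'I_r -> R)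
    (u : 'I_r -> R) (a : R) :
  quad_form M (fun i => a * u i) = a ^+ 2 * quad_form M u.
Proof.
rewrite /quad_form mulr_sumr; apply: eq_bigr => i _.
by rewrite mulr_sumr; apply: eq_bigr => j _; ring.
Qed.

Lemma quad_form_bounded (R : realType) (r : nat) (M : 'I_r -> 'I_r -> R)
    (u : 'I_r -> R) :
  sqnorm u <= 1 -> `|quad_form M u| <= \sum_i \sum_j `|M i j|.
Proof.
move=> u1.
have ui i : `|u i| <= 1.
  rewrite -(@expr_le1 _ 2) // real_normK ?num_real //; apply: le_trans u1.
  by rewrite /sqnorm (bigD1 i) //= lerDl sumr_ge0 // => j _; rewrite sqr_ge0.
apply: le_trans (ler_norm_sum _ _ _) _; apply: ler_sum => i _.
apply: le_trans (ler_norm_sum _ _ _) _; apply: ler_sum => j _.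
by rewrite normrM ler_piMr // normrM mulr_ile1.
Qed.

(** If [B] bounds the form on the unit ball then so does [theta + B / 2], by
    rounding to the grid and [quad_form_polarization].  Taking for [B] the
    supremum gives [B <= 2 * theta]. *)
Lemma quad_form_net (R : realType) (r : nat) (M : 'I_r -> 'I_r -> R) (theta : R) :
  (forall z, z \in grid_net r -> `|quad_form M (grid_vec R z)| <= theta) ->
  forall u, `|quad_form M u| <= 2 * theta * sqnorm u.
Proof.
move=> netM.
have step B : (forall u, sqnorm u <= 1 -> `|quad_form M u| <= B) ->
    forall u, sqnorm u <= 1 -> `|quad_form M u| <= theta + B / 2.
  move=> bB u u1; have [z zN uw] := grid_net_approx u1.
  have w1 := sqnorm_grid_net R zN; set w := grid_vec R z in w1 uw.
  have -> : quad_form M u = quad_form M w + (quad_form M u - quad_form M w) by ring.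
  apply: le_trans (ler_normD _ _) _; rewrite lerD ?netM //.
  rewrite quad_form_polarization normrM [X in _ * X]ger0_norm ?invr_ge0 //.
  have sa : sqnorm (fun i => 4 * (u i - w i)) <= 1 / 4.
    rewrite sqnormZ; apply: le_trans (ler_wpM2l (sqr_ge0 _) uw) _; lra.
  have sb c : c ^+ 2 = 1 / 16 -> sqnorm (fun i => c * (u i + w i)) <= 1 / 4.
    move=> c2; rewrite sqnormZ c2; have := sqnormD_le u w; lra.
  have sab c : c ^+ 2 = 1 / 16 ->
      sqnorm (fun i => 4 * (u i - w i) + c * (u i + w i)) <= 1.
    move=> /sb sc; apply: le_trans (sqnormD_le _ _) _; lra.
  have hp := bB _ (sab (1 / 4) _); have hm := bB _ (sab (- (1 / 4)) _).
  have -> : (fun i => 4 * (u i - w i) + (u i + w i) / 4) =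
      (fun i => 4 * (u i - w i) + 1 / 4 * (u i + w i)).
    by apply/funext => i; ring.
  have -> : (fun i => 4 * (u i - w i) - (u i + w i) / 4) =
      (fun i => 4 * (u i - w i) + - (1 / 4) * (u i + w i)).
    by apply/funext => i; ring.
  have := ler_normB (quad_form M (fun i => 4 * (u i - w i) + 1 / 4 * (u i + w i)))
    (quad_form M (fun i => 4 * (u i - w i) + - (1 / 4) * (u i + w i))).
  have {}hp := hp ltac:(by field); have {}hm := hm ltac:(by field).
  lra.
have theta2 u : sqnorm u <= 1 -> `|quad_form M u| <= 2 * theta.
  pose A := [set `|quad_form M u| | u in [set u | sqnorm u <= 1]].
  have A0 : A !=set0.
    exists `|quad_form M (fun=> 0)|; exists (fun=> 0) => //=.
    by rewrite /sqnorm big1 // => i _; rewrite expr0n.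
  have Aub : has_ubound A.
    by exists (\sum_i \sum_j `|M i j|) => _ [v v1 <-]; apply: quad_form_bounded.
  have supA v : sqnorm v <= 1 -> `|quad_form M v| <= sup A.
    by move=> v1; apply: ub_le_sup => //; exists v.
  have : sup A <= theta + sup A / 2.
    by apply: ge_sup => // _ [v v1 <-]; apply: step.
  by move=> h /supA; lra.
move=> u; have [u0|u0] := eqVneq (sqnorm u) 0.
  have u0i i : u i = 0.
    apply/eqP; rewrite -sqrf_eq0; move/eqP: u0.
    by rewrite psumr_eq0 => [/allP/(_ i (mem_index_enum _))|j _]; rewrite ?sqr_ge0.
  rewrite u0 mulr0 /quad_form big1 ?normr0 // => i _.
  by rewrite big1 // => j _; rewrite u0i mul0r mulr0.
have sp : 0 < sqnorm u by rewrite lt_def u0 sqnorm_ge0.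
have := theta2 (fun i => (Num.sqrt (sqnorm u))^-1 * u i).
rewrite sqnormZ quad_formZ exprVn sqr_sqrtr ?(ltW sp) // mulVf // => /(_ (lexx _)).
by rewrite normrM ger0_norm ?invr_ge0 ?(ltW sp) // ler_pdivrMl // mulrC.
Qed.

(** * Existence of the compact singular value decomposition *)

Definition dotv (R : realType) (n : nat) (x y : 'cV[R]_n) : R := (x^T *m y) 0 0.

Section RayleighMaximum.

Import numFieldNormedType.Exports.

Lemma rayleigh_max (R : realType) (n d : nat) (A : 'M[R]_(n, d)) : A != 0 ->
  exists v : 'rV[R]_d, \sum_j v 0 j ^+ 2 = 1 /\
    forall x : 'rV[R]_d, \sum_j x 0 j ^+ 2 = 1 ->
      \sum_i (\sum_j A i j * x 0 j) ^+ 2 <= \sum_i (\sum_j A i j * v 0 j) ^+ 2.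
Proof.
move=> A0.
have [j0 _] : exists j0 : 'I_d, True.
  case: d A A0 => [|d] A A0; last by exists ord0.
  by case/eqP: A0; apply/matrixP => i [].
pose S : set 'rV[R]_d := [set x | \sum_j x 0 j ^+ 2 = 1].
pose sq (x : 'rV[R]_d) : R := \sum_j x 0 j ^+ 2.
pose f (x : 'rV[R]_d) : R := \sum_i (\sum_j A i j * x 0 j) ^+ 2.
have coordC j : continuous (fun x : 'rV[R]_d => x 0 j) by exact: coord_continuous.
have sumC (k : nat) (F : 'I_k -> 'rV[R]_d -> R) : (forall i, continuous (F i)) ->
    continuous (fun x => \sum_i F i x).
  by move=> FC; apply: continuous_big => [|i _]; [exact: add_continuous | exact: FC].
have sqrC (F : 'rV[R]_d -> R) : continuous F -> continuous (fun x => F x ^+ 2).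
  by move=> FC x; exact: (cvgM (FC x) (FC x)).
have sqC : continuous sq by apply: (sumC) => j; apply: (sqrC).
have fC : continuous f.
  apply: (sumC) => i; apply: (sqrC); apply: (sumC) => j x.
  exact: (cvgM (cvg_cst (A i j)) (coordC j x)).
have S0 : S !=set0.
  exists (delta_mx 0 j0); rewrite /S /= (bigD1 j0) //= big1 ?addr0; last first.
    by move=> j jj; rewrite mxE (negbTE jj) andbF expr0n.
  by rewrite mxE !eqxx expr1n.
have cS : compact S.
  apply: bounded_closed_compact.
    exists 1; split => // M M1 x Sx.
    rewrite /= [leLHS]/Num.Def.normr /= mx_normrE.
    apply/bigmax_leP; split; first by rewrite (le_trans _ (ltW M1)).
    move=> [i j] _ /=; rewrite ord1; apply: le_trans (ltW M1).
    rewrite -(@expr_le1 _ 2) // real_normK ?num_real //.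
    rewrite -Sx (bigD1 j) //= lerDl sumr_ge0 // => k _; exact: sqr_ge0.
  have -> : S = sq @^-1` [set 1] by [].
  by apply: closed_comp; [move=> x _; exact: sqC | exact: closed_eq].
have [v vS vmax] := @EVT_max_rV R d f S S0 cS (continuous_subspaceT fC).
exists v; split; first by rewrite inE in vS.
by move=> x x1; apply: vmax; rewrite inE.
Qed.

End RayleighMaximum.

Section DotProduct.
Variables (R : realType) (n : nat).
Implicit Types x y z : 'cV[R]_n.

Lemma dotv_mx x y : x^T *m y = (dotv x y)%:M.
Proof. exact: mx11_scalar. Qed.

Lemma dotvC x y : dotv x y = dotv y x.
Proof. by rewrite /dotv -[x^T *m y]trmxK mxE trmx_mul trmxK. Qed.

Lemma dotvDr x y z : dotv x (y + z) = dotv x y + dotv x z.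
Proof. by rewrite /dotv mulmxDr mxE. Qed.

Lemma dotvZr a x y : dotv x (a *: y) = a * dotv x y.
Proof. by rewrite /dotv -scalemxAr mxE. Qed.

Lemma dotvDl x y z : dotv (y + z) x = dotv y x + dotv z x.
Proof. by rewrite !(dotvC _ x) dotvDr. Qed.

Lemma dotvZl a x y : dotv (a *: x) y = a * dotv x y.
Proof. by rewrite !(dotvC _ y) dotvZr. Qed.

Lemma dotv_sum x : dotv x x = \sum_i x i 0 ^+ 2.
Proof. by rewrite /dotv mxE; apply: eq_bigr => i _; rewrite mxE. Qed.

Lemma dotv_ge0 x : 0 <= dotv x x.
Proof. by rewrite dotv_sum sumr_ge0 // => i _; rewrite sqr_ge0. Qed.

Lemma dotv_eq0 x : dotv x x = 0 -> x = 0.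
Proof.
move/eqP; rewrite dotv_sum psumr_eq0 => [/allP h|i _]; last exact: sqr_ge0.
apply/colP => i; rewrite mxE; apply/eqP.
by rewrite -sqrf_eq0; exact: (h i (mem_index_enum _)).
Qed.

End DotProduct.

Lemma dotv_adjoint (R : realType) (n d : nat) (A : 'M[R]_(n, d)) x y :
  dotv (A^T *m x) y = dotv x (A *m y).
Proof. by rewrite /dotv trmx_mul trmxK mulmxA. Qed.

(** First-order condition at the minimum [t = 0] of
    [2 t B + t^2 G]. *)
Lemma nonneg_quadratic_linear0 (R : realType) (B G : R) :
  0 <= G -> (forall t, 0 <= 2 * t * B + t ^+ 2 * G) -> B = 0.
Proof.
move=> G0 h; apply/eqP; apply: contraT => B0.
have B2 : 0 < B ^+ 2 by rewrite exprn_even_gt0.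
have G1 : 0 < G + 1 by lra.
have := h (- B / (G + 1)).
have -> : 2 * (- B / (G + 1)) * B + (- B / (G + 1)) ^+ 2 * G =
  - (B ^+ 2 * (G + 2) / (G + 1) ^+ 2) by field; rewrite gt_eqF.
rewrite oppr_ge0 leNgt => /negP[]; apply: divr_gt0; last exact: exprn_gt0.
by apply: mulr_gt0 => //; lra.
Qed.

(** At a maximiser [v] of [|A v|] on the unit sphere, with value
    [l = |A v|^2], the nonnegative form [l |x|^2 - |A x|^2] vanishes, hence so
    does its polar form at [v].  This says that [A^T A v = l v]. *)
Lemma top_singular_vectors (R : realType) (n d : nat) (A : 'M[R]_(n, d)) :
  A != 0 -> exists (sg : R) (u : 'cV[R]_n) (v : 'cV[R]_d),
    [/\ 0 < sg, dotv u u = 1, dotv v v = 1, A *m v = sg *: u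
      & A^T *m u = sg *: v].
Proof.
move=> A0; have [w [w1 wmax]] := rayleigh_max A0.
pose v := w^T.
have sqE (x : 'cV[R]_d) : \sum_j x^T 0 j ^+ 2 = dotv x x.
  by rewrite dotv_sum; apply: eq_bigr => j _; rewrite mxE.
have AxE (x : 'cV[R]_d) :
    \sum_i (\sum_j A i j * x^T 0 j) ^+ 2 = dotv (A *m x) (A *m x).
  rewrite dotv_sum; apply: eq_bigr => i _; rewrite mxE; congr (_ ^+ 2).
  by apply: eq_bigr => j _; rewrite mxE.
have v1 : dotv v v = 1 by rewrite -sqE trmxK.
set l := dotv (A *m v) (A *m v).
have max1 (x : 'cV[R]_d) : dotv x x = 1 -> dotv (A *m x) (A *m x) <= l.
  by move=> x1; rewrite /l -!AxE trmxK; apply: wmax; rewrite sqE.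
have maxv (x : 'cV[R]_d) : dotv (A *m x) (A *m x) <= l * dotv x x.
  have [x0|x0] := eqVneq (dotv x x) 0.
    by rewrite x0 (dotv_eq0 x0) mulmx0 mulr0 /dotv mulmx0 mxE.
  have xp : 0 < dotv x x by rewrite lt_def x0 dotv_ge0.
  have := max1 ((Num.sqrt (dotv x x))^-1 *: x).
  rewrite -scalemxAr !dotvZl !dotvZr !mulrA -expr2 exprVn sqr_sqrtr ?(ltW xp) //.
  by rewrite mulVf // => /(_ erefl); rewrite ler_pdivrMl // mulrC.
have l0 : 0 < l.
  have /matrix0Pn[i [j Aij]] := A0.
  have := maxv (delta_mx j 0).
  have -> : dotv (delta_mx j 0 : 'cV[R]_d) (delta_mx j 0) = 1.
    by rewrite /dotv trmx_delta mul_delta_mx mxE !eqxx.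
  rewrite mulr1; apply: lt_le_trans.
  rewrite -colE dotv_sum (bigD1 i) //= ltr_pwDl ?sumr_ge0 // => [|k _].
    by rewrite mxE exprn_even_gt0.
  exact: sqr_ge0.
have bil (x : 'cV[R]_d) : l * dotv v x - dotv (A *m v) (A *m x) = 0.
  apply: (@nonneg_quadratic_linear0 _ _ (l * dotv x x - dotv (A *m x) (A *m x))).
    by rewrite subr_ge0.
  move=> t; have := maxv (v + t *: x).
  rewrite mulmxDr -scalemxAr !(dotvDl, dotvDr, dotvZl, dotvZr) v1.
  rewrite (dotvC x v) (dotvC (A *m x)) -/l; lra.
have AAv : A^T *m (A *m v) = l *: v.
  apply/eqP; rewrite -subr_eq0; apply/eqP/dotv_eq0; set z := (X in dotv X X).
  rewrite {1}/z dotvDl dotv_adjoint -scaleNr dotvZl.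
  by have := bil z; lra.
have sl : Num.sqrt l ^+ 2 = l by rewrite sqr_sqrtr // ltW.
have sl0 : 0 < Num.sqrt l by rewrite sqrtr_gt0.
exists (Num.sqrt l), ((Num.sqrt l)^-1 *: (A *m v)), v; split => //.
- by rewrite dotvZl dotvZr mulrA -expr2 exprVn sl mulVf // gt_eqF.
- by rewrite scalerA mulfV ?scale1r // gt_eqF.
- by rewrite -scalemxAr AAv scalerA -{2}sl expr2 mulKf // gt_eqF.
Qed.

Lemma mul_diag_inj (R : realType) (k l : nat) (D : 'M[R]_k) (x : 'M[R]_(l, k)) :
  is_diag_mx D -> (forall i, 0 < D i i) -> x *m D = 0 -> x = 0.
Proof.
move=> /is_diag_mxP Dd Dp xD; apply/matrixP => i j; rewrite mxE.
move/matrixP/(_ i j): xD; rewrite !mxE (bigD1 j) //= big1 ?addr0.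
  by move/eqP; rewrite mulf_eq0 => /orP[/eqP//|]; rewrite gt_eqF.
by move=> j' jj'; rewrite Dd ?mulr0.
Qed.

(** Deflation: subtracting [sg *: u *m v^T] for a top singular triple lowers
    the rank by one, and the singular vectors of the remainder are orthogonal to
    [u] and [v]. *)
Lemma compact_svd_of_rank (R : realType) (n d k : nat) (A : 'M[R]_(n, d)) :
  \rank A = k ->
  exists (U : 'M[R]_(n, k)) (S : 'M[R]_k) (V : 'M[R]_(d, k)),
    compact_svd A U S V.
Proof.
elim: k A => [|k IH] A rA.
  exists 0, 0, 0; split.
  - by rewrite mul0mx mul0mx; apply/eqP; rewrite -mxrank_eq0 rA.
  - by apply/matrixP => -[].
  - by apply/matrixP => -[].
  - exact: mx0_is_diag.
  - by case.
have A0 : A != 0 by rewrite -mxrank_eq0 rA.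
have [sg [u [v [sg0 u1 v1 Av Au]]]] := top_singular_vectors A0.
have sgn0 : sg != 0 by rewrite gt_eqF.
have uA : u^T *m A = sg *: v^T.
  by apply: trmx_inj; rewrite trmx_mul trmxK Au linearZ /= trmxK.
pose A' := A - sg *: (u *m v^T).
have A'v : A' *m v = 0.
  by rewrite mulmxBl Av -scalemxAl -mulmxA dotv_mx v1 mulmx1 subrr.
have uA' : u^T *m A' = 0.
  by rewrite mulmxBr uA -scalemxAr mulmxA dotv_mx u1 mul1mx subrr.
have subA : (A' <= A)%MS.
  have -> : A' = (1%:M - u *m u^T) *m A.
    by rewrite mulmxBl mul1mx -mulmxA uA -scalemxAr.
  exact: submxMl.
have vA : (v^T <= A)%MS.
  have -> : v^T = (sg^-1 *: u^T) *m A.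
    by rewrite -scalemxAl uA scalerA mulVf // scale1r.
  exact: submxMl.
have vA' : ~~ (v^T <= A')%MS.
  apply/negP => /submxP[w vw]; have := dotv_mx v v.
  rewrite vw -mulmxA A'v mulmx0 v1 => /matrixP/(_ 0 0).
  by rewrite !mxE eqxx => /eqP; rewrite eq_sym oner_eq0.
have ltA : (\rank A' < \rank A)%N.
  have : (A' < A)%MS.
    by rewrite /ltmx subA; apply: contra vA' => /(submx_trans vA).
  by rewrite ltmxErank => /andP[].
have geA : (\rank A <= (\rank A').+1)%N.
  have -> : A = A' + sg *: (u *m v^T) by rewrite subrK.
  apply: leq_trans (mxrank_add _ _) _; rewrite -[(\rank A').+1]addn1 leq_add2l.
  apply: leq_trans (mxrankS (scalemx_sub _ (submxMl _ _))) _.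
  exact: rank_leq_row.
have rA' : \rank A' = k by move: ltA geA; rewrite rA; lia.
have [U' [S' [V' [A'E UU VV Sd Sp]]]] := IH A' rA'.
have uU : u^T *m U' = 0.
  apply: (mul_diag_inj Sd Sp).
  have : u^T *m A' *m V' = 0 by rewrite uA' mul0mx.
  by rewrite A'E -!mulmxA VV mulmx1.
have Vv : V'^T *m v = 0.
  have : (U'^T *m (A' *m v))^T = 0 by rewrite A'v mulmx0 trmx0.
  rewrite A'E !mulmxA UU mul1mx !trmx_mul trmxK => h.
  apply: trmx_inj; rewrite trmx0 trmx_mul trmxK.
  apply: (@mul_diag_inj _ _ _ S'^T) => //; first by rewrite is_diag_trmx.
    by move=> i; rewrite mxE.
  by rewrite -mulmxA.
pose U : 'M[R]_(n, 1 + k) := row_mx u U'.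
pose V : 'M[R]_(d, 1 + k) := row_mx v V'.
pose S : 'M[R]_(1 + k) := block_mx sg%:M 0 0 S'.
suff : compact_svd A U S V by exists U, S, V.
split.
- rewrite /U /S /V mul_row_block !mulmx0 addr0 add0r tr_row_mx mul_row_col -A'E.
  by rewrite mul_mx_scalar -scalemxAl addrC subrK.
- rewrite /U tr_row_mx mul_col_row dotv_mx u1 UU uU.
  have -> : U'^T *m u = 0 by apply: trmx_inj; rewrite trmx_mul trmxK uU trmx0.
  by rewrite [RHS]scalar_mx_block.
- rewrite /V tr_row_mx mul_col_row dotv_mx v1 VV Vv.
  have -> : v^T *m V' = 0 by apply: trmx_inj; rewrite trmx_mul trmxK Vv trmx0.
  by rewrite [RHS]scalar_mx_block.
- apply/is_diag_mxP => i j; rewrite /S.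
  case: (split_ordP i) => i' ->; case: (split_ordP j) => j' ->.
  + by rewrite !ord1 eqxx.
  + by rewrite block_mxEur mxE.
  + by rewrite block_mxEdl mxE.
  + rewrite block_mxEdr => ij; move/is_diag_mxP: Sd; apply.
    by apply: contra ij => /eqP h; rewrite /= h.
- move=> i; rewrite /S; case: (split_ordP i) => i' ->.
  + by rewrite block_mxEul ord1 mxE eqxx.
  + by rewrite block_mxEdr.
Qed.

Lemma svd_leftP (R : realType) (n d : nat) (A : 'M[R]_(n, d)) :
  exists (S : 'M[R]_(\rank A)) (V : 'M[R]_(d, \rank A)),
    compact_svd A (svd_left A) S V.
Proof.
have [U [S [V USV]]] := compact_svd_of_rank (erefl (\rank A)).
rewrite /svd_left.
have := @xgetPex _ 0 [set U : 'M[R]_(n, \rank A) |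
   exists (Sigma : 'M[R]_(\rank A)) (V : 'M[R]_(d, \rank A)),
     compact_svd A U Sigma V].
by apply; exists U, S, V.
Qed.

(** * From the hashing matrix to the chaos *)

Lemma cauchy_schwarz_sum (R : realType) (r : nat) (a b : 'I_r -> R) :
  (\sum_i a i * b i) ^+ 2 <= sqnorm a * sqnorm b.
Proof.
have h : 0 <= \sum_i \sum_j (a i * b j - a j * b i) ^+ 2.
  by apply: sumr_ge0 => i _; apply: sumr_ge0 => j _; rewrite sqr_ge0.
have e : \sum_i \sum_j (a i * b j - a j * b i) ^+ 2 =
    2 * (sqnorm a * sqnorm b) - 2 * (\sum_i a i * b i) ^+ 2.
  transitivity (\sum_i \sum_j (a i ^+ 2 * b j ^+ 2 + b i ^+ 2 * a j ^+ 2
      - 2 * ((a i * b i) * (a j * b j)))).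
    by apply: eq_bigr => i _; apply: eq_bigr => j _; ring.
  under eq_bigr => i _ do rewrite sumrB big_split /= -!mulr_sumr.
  rewrite sumrB big_split /= -!mulr_suml -mulr_sumr -mulr_suml /sqnorm; ring.
by rewrite e in h; lra.
Qed.

Lemma sum_col_entry_sqr (R : realType) (m s : nat) (x : column_sample m s) :
  injective x.1 -> \sum_k col_entry R x k ^+ 2 = s%:R.
Proof.
move=> xi; rewrite (bigID (mem (codom x.1))) /= [X in _ + X]big1 ?addr0.
  rewrite (eq_bigr (fun=> 1)).
    by rewrite sumr_const card_codom // card_ord.
  by move=> k /codomP[t ->]; rewrite -real_normK ?num_real // norm_col_entry ?expr1n.
by move=> k kx; rewrite col_entry_notin // expr0n.
Qed.

(** The diagonal terms of [|S x|^2] sum to [|x|^2] without any error, since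
    each column of an admissible sample has exactly [s] nonzero entries. *)
Lemma hash_chaos_energy (R : realType) (m n s : nat) (x : 'cV[R]_n)
    (X : {ffun 'I_n -> column_sample m s}) :
  (0 < s)%N -> (forall j, X j \in admissible_samples m s) ->
  norm2 (hashing_mx R X *m x) ^+ 2 - norm2 x ^+ 2 =
  hash_chaos (fun j => x j 0) X / s%:R.
Proof.
move=> s0 Xad.
have sr0 : (s%:R : R) != 0 by rewrite pnatr_eq0 -lt0n.
have norm2E k (y : 'cV[R]_k) : norm2 y ^+ 2 = \sum_i y i 0 ^+ 2.
  by rewrite sqr_sqrtr // sumr_ge0 // => i _; rewrite sqr_ge0.
rewrite !norm2E.
pose c k j := col_entry R (X j) k.
have entryE k j : hashing_mx R X k j = c k j / Num.sqrt s%:R.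
  by rewrite mxE /c /col_entry mulr_suml.
have sqE k : (hashing_mx R X *m x) k 0 ^+ 2 =
    (\sum_i \sum_j c k i * c k j * (x i 0 * x j 0)) / s%:R.
  rewrite mxE; under eq_bigr => j _ do rewrite entryE mulrAC.
  rewrite -mulr_suml exprMn exprVn sqr_sqrtr // expr2; congr (_ / _).
  rewrite mulr_suml; apply: eq_bigr => i _; rewrite mulr_sumr.
  by apply: eq_bigr => j _; ring.
under eq_bigr => k _ do rewrite sqE.
rewrite -mulr_suml.
have -> : \sum_i x i 0 ^+ 2 = (\sum_k \sum_i c k i ^+ 2 * x i 0 ^+ 2) / s%:R.
  rewrite exchange_big /= mulr_suml; apply: eq_bigr => i _.
  rewrite -mulr_suml sum_col_entry_sqr; first by rewrite mulrC mulKf.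
  by have := Xad i; rewrite inE => /injectiveP.
rewrite -mulrBl; congr (_ / _); rewrite -sumrB /hash_chaos.
rewrite -(pair_bigA _ (fun k g => offdiag_coef (fun j => x j 0) g *
  (c k g.1 * c k g.2))) /=.
apply: eq_bigr => k _; rewrite -sumrB.
rewrite -(pair_bigA _ (fun i j => offdiag_coef (fun j => x j 0) (i, j) *
  (c k i * c k j))) /=.
apply: eq_bigr => i _; rewrite (bigD1 i) //= [RHS](bigD1 i) //=.
rewrite /offdiag_coef /= eqxx !mul0r add0r.
have -> : c k i * c k i * (x i 0 * x i 0) = c k i ^+ 2 * x i 0 ^+ 2 by ring.
rewrite addrAC subrr add0r; apply: eq_bigr => j; rewrite eq_sym => -> /=.
by rewrite mul1r mulrC.
Qed.

Lemma orthonormal_coord_le (R : realType) (n r : nat) (U : 'M[R]_(n, r)) (nu : R)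
    (w : 'I_r -> R) (i : 'I_n) :
  norm2 (row i U)^T <= nu -> sqnorm w <= 1 ->
  `|(U *m \col_j w j) i 0| <= nu.
Proof.
move=> Unu w1.
have U0 : 0 <= norm2 (row i U)^T by exact: sqrtr_ge0.
have nu0 : 0 <= nu by exact: le_trans Unu.
rewrite -(@ler_pXn2r _ 2) ?nnegrE // real_normK ?num_real //.
have -> : (U *m \col_j w j) i 0 = \sum_j U i j * w j.
  by rewrite mxE; apply: eq_bigr => j _; rewrite mxE.
apply: le_trans (cauchy_schwarz_sum _ _) _.
apply: (@le_trans _ _ (norm2 (row i U)^T ^+ 2)); last first.
  by rewrite lerXn2r ?nnegrE.
rewrite sqr_sqrtr; last by apply: sumr_ge0 => j _; rewrite sqr_ge0.
rewrite -[leRHS]mulr1 ler_pM ?sqnorm_ge0 //.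
by rewrite /sqnorm; apply: ler_sum => j _; rewrite !mxE.
Qed.

Lemma norm2_dotv (R : realType) (n : nat) (x : 'cV[R]_n) :
  norm2 x ^+ 2 = dotv x x.
Proof.
by rewrite dotv_sum sqr_sqrtr // sumr_ge0 // => i _; rewrite sqr_ge0.
Qed.

Lemma norm2_orthonormal (R : realType) (n r : nat) (U : 'M[R]_(n, r))
    (u : 'cV[R]_r) : U^T *m U = 1%:M -> norm2 (U *m u) ^+ 2 = norm2 u ^+ 2.
Proof.
by move=> UU; rewrite !norm2_dotv /dotv trmx_mul mulmxA -(mulmxA u^T) UU mulmx1.
Qed.

Lemma quad_form_mx (R : realType) (r : nat) (M : 'M[R]_r) (u : 'cV[R]_r) :
  quad_form (fun i j => M i j) (fun i => u i 0) = (u^T *m M *m u) 0 0.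
Proof.
rewrite mxE; under [RHS]eq_bigr => j _ do rewrite mxE mulr_suml.
rewrite exchange_big; apply: eq_bigr => i _; apply: eq_bigr => j _.
by rewrite mxE; ring.
Qed.

Lemma subspace_embedding_of_net (R : realType) (m n d : nat) (eps : R)
    (A : 'M[R]_(n, d)) (S : 'M[R]_(m, n)) :
  (forall z, z \in grid_net (\rank A) ->
    `|norm2 (S *m (svd_left A *m \col_i grid_vec R z i)) ^+ 2
      - norm2 (svd_left A *m \col_i grid_vec R z i) ^+ 2| <= eps / 2) ->
  subspace_embedding eps S A.
Proof.
move=> netS; have [Sg [V [AE UU _ _ _]]] := svd_leftP A.
set U := svd_left A in netS AE UU.
pose M := (S *m U)^T *m (S *m U) - U^T *m U.
have ME u : norm2 (S *m (U *m u)) ^+ 2 - norm2 (U *m u) ^+ 2 =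
    quad_form (fun i j => M i j) (fun i => u i 0).
  rewrite quad_form_mx /M mulmxBr mulmxBl !norm2_dotv /dotv.
  by rewrite [RHS]mxE [X in _ = _ + X]mxE !trmx_mul !mulmxA.
have net z : z \in grid_net (\rank A) ->
    `|quad_form (fun i j => M i j) (grid_vec R z)| <= eps / 2.
  move=> /netS; rewrite ME; congr (`|quad_form _ _| <= _).
  by apply/funext => i; rewrite mxE.
move=> _ [z ->]; rewrite AE -!mulmxA; set u := Sg *m (V^T *m z).
have := quad_form_net net (fun i => u i 0).
rewrite -ME (norm2_orthonormal u UU).
have -> : sqnorm (fun i => u i 0) = norm2 u ^+ 2 by rewrite norm2_dotv dotv_sum.
rewrite ler_norml => /andP[h1 h2]; lra.
Qed.

(** * Choice of the parameters *)

Lemma min_sqr_le (R : realType) (a b : R) : 0 <= a -> 0 <= b ->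
  Num.min a b ^+ 2 <= a ^+ 2 /\ Num.min a b ^+ 2 <= b ^+ 2.
Proof.
move=> a0 b0; have m0 : 0 <= Num.min a b by rewrite le_min a0.
by split; rewrite lerXn2r ?nnegrE // ge_min lexx ?orbT.
Qed.

(** Here [lam] is chosen so that [(2 / (eps s)) ^ p] times the resulting
    moment bound is of order [K ^ (- p)].  The size of [m] gives the bounds on
    [d], and the two terms of the minimum in [nu] give the two bounds on [c]. *)
Lemma moment_parameters (R : realType) (m s p : nat) (K eps E L : R) :
  let C2 : R := (36 * K)^-1 in
  let b := ln (E / (C2 * eps)) in
  let nu := Num.sqrt s%:R * 4^-1 * (Num.sqrt C2 * Num.sqrt eps *
              Num.min (b / L) (Num.sqrt (ln E / L))) in
  let lam := K * p%:R / (eps * s%:R) in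
  let d := expR 1 ^+ 2 * (lam * (s%:R / m%:R)) in
  let c := expR 1 * lam * nu ^+ 2 in
  1 <= K -> (0 < s)%N -> (0 < m)%N -> 0 < eps < 1 -> 1 <= E -> 0 < L ->
  L <= p%:R <= 2 * L -> E * C2 ^- 2 * eps ^- 2 * L <= m%:R ->
  [/\ 0 <= b, d ^+ 2 * E <= p%:R / m%:R / 2, expR (4 * c) <= E,
      d * expR b <= 1 / 2 & c <= (b / 6) ^+ 2 / p%:R].
Proof.
move=> C2 b nu lam d c K1 s0 m0 /andP[e0 e1] E1 L0 /andP[Lp pL] mE.
have K0 : 0 < K by exact: lt_le_trans K1.
have C20 : 0 < C2 by rewrite invr_gt0 mulr_gt0.
have E0 : 0 < E by exact: lt_le_trans E1.
have s0r : 0 < s%:R :> R by rewrite ltr0n.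
have m0r : 0 < m%:R :> R by rewrite ltr0n.
have p0r : 0 < p%:R :> R by exact: lt_le_trans Lp.
have C21 : C2 <= 1.
  by rewrite invf_le1 ?mulr_gt0 //; lra.
have ce0 : 0 < C2 * eps by rewrite mulr_gt0.
have ratio1 : 1 <= E / (C2 * eps).
  by rewrite ler_pdivlMr // mul1r; apply: le_trans E1; rewrite mulr_ile1 // ltW.
have b0 : 0 <= b by exact: ln_ge0.
have expb : expR b = E / (C2 * eps) by rewrite lnK // posrE divr_gt0.
have lnE0 : 0 <= ln E by exact: ln_ge0.
have e1_0 : 0 < expR 1 :> R by exact: expR_gt0.
have e2le : expR 1 ^+ 2 <= 9 :> R.
  have := expR1_le3 R; nra.
have K2 : C2 * K = 1 / 36 by rewrite /C2; field; rewrite gt_eqF.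
(* the row bound m >= E L / (C2 eps)^2, cleared of denominators *)
have mE' : E * L <= m%:R * (C2 * eps) ^+ 2.
  rewrite -ler_pdivrMr ?exprn_gt0 //; apply: le_trans mE.
  by rewrite le_eqVlt; apply/orP; left; apply/eqP; field; rewrite !gt_eqF.
have dE : d = expR 1 ^+ 2 * K * p%:R / (eps * m%:R).
  by rewrite /d /lam; field; rewrite !gt_eqF.
have nu2 : lam * nu ^+ 2 = p%:R / 576 * Num.min (b / L) (Num.sqrt (ln E / L)) ^+ 2.
  rewrite /nu !exprMn !sqr_sqrtr ?ltW // /lam.
  have -> : K = 1 / (36 * C2) by rewrite /C2; field; rewrite gt_eqF.
  by field; rewrite !gt_eqF.
have [min1 min2] : Num.min (b / L) (Num.sqrt (ln E / L)) ^+ 2 <= (b / L) ^+ 2 /\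
    Num.min (b / L) (Num.sqrt (ln E / L)) ^+ 2 <= ln E / L.
  have := @min_sqr_le R (b / L) (Num.sqrt (ln E / L)).
  rewrite sqr_sqrtr ?divr_ge0 ?(ltW L0) // => h.
  by apply: h; rewrite ?divr_ge0 ?(ltW L0) ?sqrtr_ge0.
set mn := Num.min _ _ ^+ 2 in nu2 min1 min2.
have mn0 : 0 <= mn by rewrite sqr_ge0.
clearbody mn.
have cle : c <= p%:R / 192 * mn.
  have z0 := mulr_ge0 (divr_ge0 (ltW p0r) (ler0n R 576)) mn0.
  rewrite /c -mulrA nu2; apply: le_trans (ler_wpM2r z0 (expR1_le3 R)) _; lra.
split => //.
- rewrite dE.
  have -> : (expR 1 ^+ 2 * K * p%:R / (eps * m%:R)) ^+ 2 * E =
     (p%:R / m%:R / 2) * (2 * (expR 1 ^+ 2) ^+ 2 * p%:R * E * K ^+ 2 / (eps ^+ 2 * m%:R)).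
    by field; rewrite !gt_eqF.
  have pm0 := divr_ge0 (divr_ge0 (ltW p0r) (ltW m0r)) (ler0n R 2).
  have em0 : 0 < eps ^+ 2 * m%:R by rewrite mulr_gt0 // exprn_gt0.
  rewrite ler_piMr // (ler_pdivrMr _ _ em0) mul1r.
  have h : m%:R * eps ^+ 2 = m%:R * (C2 * eps) ^+ 2 * (1296 * K ^+ 2).
    by rewrite /C2; field; rewrite gt_eqF.
  rewrite [eps ^+ 2 * _]mulrC h.
  apply: (@le_trans _ _ (E * L * (1296 * K ^+ 2))); last first.
    exact: (ler_wpM2r (mulr_ge0 (ler0n R 1296) (sqr_ge0 K)) mE').
  have q0 := mulr_ge0 (ltW E0) (sqr_ge0 K).
  have pq0 := mulr_ge0 (ltW p0r) q0.
  have Lq0 := mulr_ge0 (ltW L0) q0.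
  have e4 : (expR 1 ^+ 2) ^+ 2 <= 81 :> R.
    have e20 : 0 <= expR 1 ^+ 2 :> R by exact: sqr_ge0.
    by have := lerXn2r 2 e20 (ler0n R 9) e2le; lra.
  have h1 := ler_wpM2r q0 pL; have h2 := ler_wpM2r pq0 e4.
  by clear - h1 h2 Lq0 pq0; lra.
- rewrite -[leRHS](lnK (_ : E \is Num.pos)) ?posrE // ler_expR.
  have : p%:R * (ln E / L) <= 2 * ln E.
    by rewrite mulrA ler_pdivrMr //; nra.
  have : p%:R / 192 * mn <= p%:R / 192 * (ln E / L).
    exact: (ler_wpM2l (divr_ge0 (ltW p0r) (ler0n R 192))).
  lra.
- rewrite dE expb.
  have -> : expR 1 ^+ 2 * K * p%:R / (eps * m%:R) * (E / (C2 * eps)) =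
     expR 1 ^+ 2 * p%:R * E * (C2 * K) / (m%:R * (C2 * eps) ^+ 2).
    by field; rewrite !gt_eqF.
  rewrite ler_pdivrMr ?mulr_gt0 ?exprn_gt0 // K2.
  apply: (@le_trans _ _ (1 / 2 * (E * L))); last first.
    exact: (ler_wpM2l (divr_ge0 (ler0n R 1) (ler0n R 2)) mE').
  have h1 := ler_wpM2r (ltW E0) pL.
  have z0 := mulr_ge0 (ltW p0r) (ltW E0); have h2 := ler_wpM2r z0 e2le.
  by clear - z0 h1 h2; lra.
- apply: le_trans cle _.
  apply: (@le_trans _ _ (p%:R / 192 * (b / L) ^+ 2)).
    exact: (ler_wpM2l (divr_ge0 (ltW p0r) (ler0n R 192))).
  rewrite !expr_div_n ler_pdivlMr //.
  have -> : p%:R / 192 * (b ^+ 2 / L ^+ 2) * p%:R = b ^+ 2 * ((p%:R / L) ^+ 2 / 192).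
    by field; rewrite gt_eqF.
  rewrite ler_wpM2l ?sqr_ge0 //.
  have : p%:R / L <= 2 by rewrite ler_pdivrMr.
  have := divr_ge0 (ltW p0r) (ltW L0).
  nra.
Qed.

(** * Probability of failure *)

(** As [p >= 4 r + ln (1 / delta)], the first [4 r] factors [2 ^ (- 17)] absorb
    the size of the net and the others are at most [1 / e] each. *)
Lemma net_union_tail (R : realType) (r p : nat) (delta : R) :
  0 < delta < 1 -> rlog r delta <= p%:R ->
  2 ^+ (66 * r) * (2 ^+ 17)^-1 ^+ p <= delta.
Proof.
move=> /andP[d0 d1]; rewrite /rlog => Lp.
have l0 : 0 <= ln (1 / delta) by rewrite ln_ge0 // ler_pdivlMr // mul1r ltW.
have rp : (4 * r <= p)%N by rewrite -(ler_nat R) natrM; lra.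
have {}Lp : ln (1 / delta) <= (p - 4 * r)%:R by rewrite natrB // natrM; lra.
set q := (p - 4 * r)%N in Lp.
have -> : p = (4 * r + q)%N by rewrite /q subnKC.
have dq : expR 1 ^- q <= delta.
  rewrite -[leRHS]invrK lef_pV2 ?posrE ?exprn_gt0 ?expR_gt0 ?invr_gt0 //.
  rewrite -expRM_natl mulr1 -[leLHS](lnK (_ : delta^-1 \is Num.pos)) ?posrE ?invr_gt0 //.
  by rewrite ler_expR -[delta^-1]mul1r.
apply: le_trans dq; rewrite exprD mulrA.
have two0 k : 0 < 2 ^+ k :> R by rewrite exprn_gt0.
apply: (@le_trans _ _ (1 * (2 ^+ 17)^-1 ^+ q)).
  rewrite ler_wpM2r ?exprn_ge0 ?invr_ge0 ?(ltW (two0 _)) //.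
  rewrite exprVn -exprM ler_pdivrMr // mul1r ler_weXn2l ?ler1n //; lia.
have e17 : expR 1 <= 2 ^+ 17 :> R.
  apply: le_trans (expR1_le3 R) _; apply: (@le_trans _ _ (2 ^+ 2)); first by lra.
  by rewrite ler_weXn2l // ler1n.
rewrite mul1r exprVn lef_pV2 ?posrE ?exprn_gt0 ?expR_gt0 //.
by rewrite lerXn2r ?nnegrE ?expR_ge0 ?(ltW (two0 _)).
Qed.

Lemma hash_wt_ge0 (R : realType) (m n s : nat)
    (X : {ffun 'I_n -> column_sample m s}) : 0 <= hash_wt R X.
Proof.
by apply: prodr_ge0 => j _; rewrite /col_wt; case: ifP => // _; rewrite invr_ge0.
Qed.

Lemma hash_wt_inadmissible (R : realType) (m n s : nat)
    (X : {ffun 'I_n -> column_sample m s}) (j : 'I_n) :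
  X j \notin admissible_samples m s -> hash_wt R X = 0.
Proof. by move=> /negbTE Xj; rewrite /hash_wt (bigD1 j) //= /col_wt Xj mul0r. Qed.

(** For a sample that is not an embedding, some grid vector violates the
    bound [eps / 2], so the [p]-th power of the rescaled chaos at this vector is
    at least 1 while the other even powers are nonnegative.  This is the union
    bound together with the Markov inequality. *)
Lemma failure_weight_le_moments (R : realType) (m n d s p : nat) (eps C : R)
    (A : 'M[R]_(n, d)) :
  (0 < s)%N -> 0 < eps -> ~~ odd p -> 0 <= C ->
  (forall z, z \in grid_net (\rank A) ->
     (2 / (eps * s%:R)) ^+ p *
     (\sum_X hash_wt R X * hash_chaos (m := m) (s := s)
        (fun j => (svd_left A *m \col_i grid_vec R z i) j 0) X ^+ p) <= C) ->
  \sum_(X : {ffun 'I_n -> column_sample m s} |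
      ~~ `[< subspace_embedding eps (hashing_mx R X) A >]) hash_wt R X
  <= 2 ^+ (66 * \rank A) * C.
Proof.
move=> s0 e0 evp C0 momC.
have sr0 : 0 < s%:R :> R by rewrite ltr0n.
have es0 : 0 < eps * s%:R by rewrite mulr_gt0.
pose Q z (X : {ffun 'I_n -> column_sample m s}) := 2 / (eps * s%:R) *
  hash_chaos (fun j => (svd_left A *m \col_i grid_vec R z i) j 0) X.
have Q0 z X : 0 <= Q z X ^+ p by rewrite exprn_even_ge0.
apply: (@le_trans _ _ (\sum_X hash_wt R X *
    \sum_(z in grid_net (\rank A)) Q z X ^+ p)).
  rewrite [leRHS](bigID (fun X : {ffun 'I_n -> column_sample m s} =>
    ~~ `[< subspace_embedding eps (hashing_mx R X) A >])).
  rewrite -[leLHS]addr0 lerD //; last first.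
    by apply: sumr_ge0 => X _; rewrite mulr_ge0 ?hash_wt_ge0 ?sumr_ge0.
  apply: ler_sum => X Xbad.
  have [/forallP ad|/forallPn[j Xj]] :=
      boolP [forall j, X j \in admissible_samples m s]; last first.
    by rewrite (hash_wt_inadmissible R Xj) mul0r.
  rewrite ler_peMr ?hash_wt_ge0 //.
  have [z zN zbig] : exists2 z, z \in grid_net (\rank A) &
      eps / 2 < `|norm2 (hashing_mx R X *m (svd_left A *m \col_i grid_vec R z i)) ^+ 2
      - norm2 (svd_left A *m \col_i grid_vec R z i) ^+ 2|.
    apply: contrapT => h; move/asboolPn: Xbad; apply.
    apply: subspace_embedding_of_net => z zN; rewrite leNgt; apply/negP => zb.
    by apply: h; exists z.
  rewrite (bigD1 z) //= -[leLHS]addr0 lerD ?sumr_ge0 //.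
  rewrite hash_chaos_energy // in zbig.
  have Qbig : 1 <= `|Q z X|.
    rewrite /Q normrM ger0_norm; last by rewrite divr_ge0 // ltW.
    move: zbig; rewrite normrM [`|_^-1|]ger0_norm ?invr_ge0 // => /ltW.
    rewrite ler_pdivlMr // => h.
    by rewrite mulrAC ler_pdivlMr // mul1r; lra.
  by rewrite -[Q z X ^+ p]ger0_norm // normrX exprn_ege1.
under eq_bigr => X _ do rewrite mulr_sumr.
rewrite exchange_big /=.
apply: (@le_trans _ _ (\sum_(z in grid_net (\rank A)) C)).
  apply: ler_sum => z zN; apply: le_trans (momC z zN).
  rewrite mulr_sumr le_eqVlt; apply/orP; left; apply/eqP.
  by apply: eq_bigr => X _; rewrite /Q exprMn mulrCA.
rewrite sumr_const -[_ *+ #|_|]mulr_natl ler_wpM2r // -natrX ler_nat.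
exact: card_grid_net.
Qed.

Lemma measure_bigsetU_le (R : realType) (dT : measure_display)
    (T : measurableType dT) (P : probability T R) (I : Type) (q : seq I)
    (Q : pred I) (F : I -> set T) :
  (forall i, measurable (F i)) ->
  (P (\big[setU/set0]_(i <- q | Q i) F i) <= \sum_(i <- q | Q i) P (F i))%E.
Proof.
move=> mF; elim: q => [|i q IH]; first by rewrite !big_nil measure0.
rewrite !big_cons; case: ifP => // _.
have mU : measurable (\big[setU/set0]_(j <- q | Q j) F j).
  exact: bigsetU_measurable.
by apply: le_trans (measureU2 P (mF i) mU) _; exact: leeD2l.
Qed.

(** Independence gives the joint law of the columns, so that the probability
    of failure is at most a finite sum of product weights. *)
Lemma s_hashing_law (R : realType) (dT : measure_display)
    (T : measurableType dT) (P : probability T R) (m n s : nat)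
    (S : T -> 'M[R]_(m, n)) (G : 'M[R]_(m, n) -> Prop) :
  s_hashing P s S ->
  ((1 - \sum_(X : {ffun 'I_n -> column_sample m s} |
        ~~ `[< G (hashing_mx R X) >]) hash_wt R X)%:E
   <= P [set w | G (S w)])%E.
Proof.
move=> [X [mX lawX indX SX]].
pose F (x : {ffun 'I_n -> column_sample m s}) : set T :=
  \bigcap_(j in [set` [set: 'I_n]%SET]) (X j @^-1` [set x j]).
have mF x : measurable (F x) by apply: fin_bigcap_measurable.
have PF x : P (F x) = (hash_wt R x)%:E.
  rewrite /F indX /hash_wt -prodEFin big_mkcond /=.
  by apply: eq_bigr => j _; rewrite finset.in_setT lawX /col_wt.
pose B : set T := \big[setU/set0]_(x : {ffun 'I_n -> column_sample m s} |
    ~~ `[< G (hashing_mx R x) >]) F x.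
have mB : measurable B by apply: bigsetU_measurable.
have -> : [set w | G (S w)] = ~` B.
  apply/seteqP; split=> w /=.
    move=> GS; rewrite /B -bigcup_seq_cond => -[x /= /andP[_ /asboolPn nG] Fx].
    apply: nG; rewrite (_ : hashing_mx R x = S w) // SX.
    by apply/matrixP => i j; rewrite !mxE (Fx j) //= finset.in_setT.
  apply: contra_notP => nG; rewrite /B -bigcup_seq_cond.
  have E : hashing_mx R [ffun j => X j w] = S w.
    by rewrite SX; apply/matrixP => i j; rewrite !mxE ffunE.
  exists [ffun j => X j w]; last by move=> j _ /=; rewrite ffunE.
  by rewrite /= mem_index_enum E; apply/asboolPn.
rewrite probability_setC // EFinB leeB //.
apply: le_trans (measure_bigsetU_le _ _ _ mF) _.
by rewrite -sumEFin; apply: lee_sum => x _; rewrite PF.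
Qed.

(** Uses [p! <= p ^ p] and [2 e <= 6]. *)
Lemma rescaled_moment_le (R : realType) (K B eps sr M : R) (p : nat) :
  0 < K -> 0 < B -> 6 * B <= K -> 0 < eps -> 0 < sr -> (0 < p)%N ->
  (K * p%:R / (eps * sr)) ^+ p / p`!%:R * M <= expR 1 ^+ p ->
  (2 / (eps * sr)) ^+ p * M <= B^-1 ^+ p.
Proof.
move=> K0 B0 BK e0 s0 p0 hM.
have p0r : 0 < p%:R :> R by rewrite ltr0n.
have f0 : 0 < p`!%:R :> R by rewrite ltr0n fact_gt0.
have Kp0 : 0 < 2 / (K * p%:R) by rewrite divr_gt0 // mulr_gt0.
have c0 : 0 <= (2 / (K * p%:R)) ^+ p * p`!%:R.
  by rewrite mulr_ge0 ?(ltW f0) // exprn_ge0 // ltW.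
have -> : (2 / (eps * sr)) ^+ p * M = ((2 / (K * p%:R)) ^+ p * p`!%:R) *
    ((K * p%:R / (eps * sr)) ^+ p / p`!%:R * M).
  rewrite [RHS]mulrA; congr (_ * _); rewrite mulrACA -exprMn divff ?gt_eqF // mulr1.
  by congr (_ ^+ _); field; rewrite !gt_eqF.
apply: le_trans (ler_wpM2l c0 hM) _.
apply: (@le_trans _ _ ((2 / (K * p%:R)) ^+ p * p%:R ^+ p * expR 1 ^+ p)).
  rewrite ler_wpM2r ?exprn_ge0 ?expR_ge0 //.
  rewrite ler_wpM2l ?exprn_ge0 ?(ltW Kp0) //.
  by rewrite -natrX ler_nat fact_le_pow.
rewrite -!exprMn.
have -> : 2 / (K * p%:R) * p%:R * expR 1 = 2 * expR 1 / K.
  by field; rewrite !gt_eqF.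
have h : 2 * expR 1 <= 6 :> R by have := expR1_le3 R; lra.
have h0 : 0 <= 2 * expR 1 :> R by rewrite mulr_ge0 ?expR_ge0.
rewrite lerXn2r ?nnegrE ?invr_ge0 ?(ltW B0) //; first by rewrite divr_ge0 // ltW.
rewrite ler_pdivrMr // [leRHS]mulrC ler_pdivlMr //.
by apply: le_trans BK; rewrite ler_wpM2r // ltW.
Qed.

Lemma coherence_row_le (R : realType) (n d : nat) (A : 'M[R]_(n, d)) (i : 'I_n) :
  norm2 (row i (svd_left A))^T <= coherence A.
Proof. exact: (le_bigmax 0 (fun i => norm2 (row i (svd_left A))^T) i). Qed.

Lemma even_above (R : realType) (L : R) : 2 <= L ->
  exists p : nat, [/\ (0 < p)%N, ~~ odd p & L <= p%:R <= 2 * L].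
Proof.
move=> L2.
have [t /andP[h1 h2]] : exists t : nat, t%:R <= L / 2 < t.+1%:R.
  by exists (Num.truncn (L / 2)); apply: truncn_itv; lra.
exists t.+1.*2; rewrite odd_double -muln2 natrM; split => //.
have tS : t.+1%:R = t%:R + 1 :> R by rewrite -natr1.
by rewrite tS in h2 *; apply/andP; split; lra.
Qed.

(** For a grid vector [w] in the unit ball, [U w] has norm at most 1 and
    coordinates bounded by the coherence, so [hash_chaos_moment_exp] applies to
    it with the parameters of [moment_parameters]. *)
Lemma hash_failure_le (R : realType) (n d m s : nat) (K eps delta E : R)
    (A : 'M[R]_(n, d)) :
  let C2 := (36 * K)^-1 in
  let L := rlog (\rank A) delta in
  1 <= K -> 6 * 2 ^+ 17 <= K -> (0 < \rank A)%N -> (0 < m)%N -> (0 < s <= m)%N ->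
  0 < eps < 1 -> 0 < delta < 1 -> 1 <= E ->
  E * C2 ^- 2 * eps ^- 2 * L <= m%:R ->
  coherence A <= Num.sqrt s%:R * 4^-1 * (Num.sqrt C2 * Num.sqrt eps *
              Num.min (ln (E / (C2 * eps)) / L) (Num.sqrt (ln E / L))) ->
  \sum_(X : {ffun 'I_n -> column_sample m s} |
      ~~ `[< subspace_embedding eps (hashing_mx R X) A >]) hash_wt R X <= delta.
Proof.
move=> C2 L K1 KB r0 m0 /andP[s0 sm] eps01 delta01 E1 mE cohA.
have K0 : 0 < K by exact: lt_le_trans K1.
have /andP[e0 _] := eps01.
have L4 : 4 <= L.
  have l0 : 0 <= ln (1 / delta).
    by case/andP: delta01 => d0 d1; rewrite ln_ge0 // ler_pdivlMr // mul1r ltW.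
  have r1 : 1 <= (\rank A)%:R :> R by rewrite ler1n.
  by rewrite /L /rlog; clear - l0 r1; lra.
have [p [p0 evp Lp]] : exists p : nat, [/\ (0 < p)%N, ~~ odd p & L <= p%:R <= 2 * L].
  by apply: even_above; clear - L4; lra.
have L0 : 0 < L by clear - L4; lra.
have [b0 hE h4 hb hc] := moment_parameters K1 s0 m0 eps01 E1 L0 Lp mE.
set nu := (X in coherence A <= X) in cohA.
have sr0 : 0 < s%:R :> R by rewrite ltr0n.
have B0 : 0 < 2 ^+ 17 :> R by rewrite exprn_gt0.
have Bp0 : 0 <= (2 ^+ 17)^-1 ^+ p :> R by rewrite exprn_ge0 // invr_ge0 ltW.
have /andP[Lp1 _] := Lp.
apply: le_trans (net_union_tail delta01 Lp1).
apply: (@failure_weight_le_moments R m n d s p) => // z zN.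
apply: (rescaled_moment_le K0 B0 KB e0 sr0 p0).
have w1 := sqnorm_grid_net R zN.
have lam0 : 0 <= K * p%:R / (eps * s%:R).
  by rewrite divr_ge0 // ?mulr_ge0 // ltW // mulr_gt0.
apply: (hash_chaos_moment_exp m0 sm lam0 b0 E1 _ _ hE h4 hb hc).
  move=> j; apply: orthonormal_coord_le w1.
  by apply: le_trans cohA; exact: coherence_row_le.
have [Sg [V [_ UU _ _ _]]] := svd_leftP A.
have := norm2_orthonormal (\col_i grid_vec R z i) UU.
rewrite !norm2_dotv !dotv_sum => ->; apply: le_trans w1.
by rewrite /sqnorm; apply: ler_sum => i _; rewrite mxE.
Qed.

Theorem theorem3 (R : realType) :
  exists C1 C2 C3 CM Cnu Cs : R,
    [/\ 0 < C1, 0 < C2 & 0 < C3] /\ [/\ 0 < CM, 0 < Cnu & 0 < Cs] /\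
    forall (r d n m s : nat) (eps delta E : R),
      (0 < r)%N -> (r <= d)%N -> (d <= n)%N ->
      0 < eps < 1 -> 0 < eps < C3 -> 0 < delta < C3 ->
      (0 < m)%N -> (0 < s)%N -> 0 < E ->
      1 <= (s%:R : R) <= Cs * C2^-1 * eps^-1 * rlog r delta ->
      CM <= E <= C2 ^+ 2 * eps ^+ 2 * s%:R * (rlog r delta)^-1 *
                 expR (Cs * (C2 * eps * s%:R)^-1 * rlog r delta) ->
      Num.max (E * C2 ^- 2 * eps ^- 2 * rlog r delta) (s%:R * expR 1) <= m%:R ->
      forall A : 'M[R]_(n, d),
        \rank A = r ->
        coherence A <= Num.sqrt s%:R * Cnu * C1^-1 * mu_bar C1 C2 E r eps delta ->
        forall (dT : measure_display) (T : measurableType dT)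
               (P : probability T R) (S : T -> 'M[R]_(m, n)),
          s_hashing P s S ->
          ((1 - delta)%:E <= P [set w | subspace_embedding eps (S w) A])%E.
Proof.
have [K [K1 KB]] : exists K : R, 1 <= K /\ 6 * 2 ^+ 17 <= K.
  have B1 : 1 <= 2 ^+ 17 :> R by rewrite exprn_ege1 // ler1n.
  by exists (6 * 2 ^+ 17); split=> //; move: B1; set B := 2 ^+ 17; lra.
have K0 : 0 < K by exact: lt_le_trans K1.
(* In K, the 6 absorbs the factor 2 e of the moment bound, and 2 ^ 17 for each
   unit of p outweighs the net.  The values 36 and 1 / 4 satisfy the four
   estimates of moment_parameters. *)
exists 1, (36 * K)^-1, 1, 1, 4^-1, 1; split; [|split].
- by split; rewrite ?ltr01 // invr_gt0 mulr_gt0.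
- by split; rewrite ?ltr01 // invr_gt0.
move=> r d n m s eps delta E r0 _ _ eps01 _ delta01 m0 s0 E0 _ /andP[E1 _].
rewrite ge_max => /andP[mE msE] A rA cohA dT T P S hS.
apply: le_trans (s_hashing_law (fun M => subspace_embedding eps M A) hS).
rewrite lee_fin lerB //; subst r.
have sm : (s <= m)%N.
  rewrite -(ler_nat R); apply: le_trans msE.
  by rewrite ler_peMr //; have := expR_ge1Dx (1 : R); lra.
have s0m : (0 < s <= m)%N by rewrite s0.
apply: (hash_failure_le K1 KB r0 m0 s0m eps01 delta01 E1 mE).
by move: cohA; rewrite /mu_bar invr1 mulr1 mul1r.
Qed.
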